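(* Fix $p\in\mathbb{N}$ and a sparse coefficient vector $\beta\in\mathbb{R}^p$ (some coordinates may be zero). For each $n$ let $X=X_n$ be an $n\times p$ real matrix and $y=X\beta+e$ with $e\sim N(0,\sigma^2I_n)$. Let $s>0$, $\epsilon>0$, $s_n=s/n^{1/2+\epsilon}$ (so $s_n\to0$), let $\lambda_n\ge0$ satisfy $\lambda_n/\sqrt n\to\lambda_\circ\ge0$, and suppose $X'X/n\to\Sigma$ with $\Sigma$ non-singular. Let $\hat\beta_n$ be a minimizer over $b\in\mathbb{R}^p$ of $$(y-Xb)'(y-Xb)+\lambda_n\sum_{i=1}^p b_i\Bigl(2\Phi\bigl(\tfrac{b_i}{s_n},0,\tfrac1{\sqrt2}\bigr)-1\Bigr).$$ Then, as $n\to\infty$, $\sqrt n(\hat\beta_n-\beta)$ converges in distribution to $\arg\min_{u\in\mathbb{R}^p}k(u)$, where $$k(u)=-2u'W+u'\Sigma u+\lambda_\circ\sum_{i=1}^p\Bigl\{u_i\,\mathrm{sign}(\beta_i)I(\beta_i\ne0)+|u_i|I(\beta_i=0)\Bigr\}$$ and $W\sim N(0,\sigma^2\Sigma)$.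
   Context: $\Phi(z,0,\frac1{\sqrt2})$ is the cumulative distribution function at $z$ of the normal distribution with mean $0$ and standard deviation $\frac1{\sqrt2}$, so $2\Phi(z,0,\frac1{\sqrt2})-1=\mathrm{erf}(z)=\frac{2}{\sqrt\pi}\int_0^z e^{-t^2}dt$. A prime denotes transpose, $I(\cdot)$ is the indicator, and $\mathrm{sign}(t)$ is $1$ for $t>0$ and $-1$ for $t<0$. *)

(* Defs.v *)
From HB Require Import structures.
From mathcomp Require Import all_boot all_order all_algebra.
From mathcomp Require Import all_classical all_reals all_analysis.

Set Implicit Arguments.
Unset Strict Implicit.
Unset Printing Implicit Defensive.

Import Order.TTheory GRing.Theory Num.Theory.
Import numFieldNormedType.Exports.

Local Open Scope classical_set_scope.
Local Open Scope ring_scope.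

(* The scalar represented by a 1 x 1 matrix such as u'v. *)
Definition mx11_val (R : realType) (A : 'M[R]_1) : R := A ord0 ord0.

Definition random_vector (R : realType) (d : measure_display)
    (T : measurableType d) (q : nat) (Z : T -> 'cV[R]_q) : Prop :=
  forall i : 'I_q, measurable_fun [set: T] (fun w => Z w i ord0).

(* N(m, v) is parametrized by its variance v. The library's [normal_prob m s]
   takes the standard deviation s, and for s = 0 it is the uniform law on
   [0, 1] instead of the point mass at m. *)
Definition normal_law (R : realType) (m v : R) : set R -> \bar R :=
  if v == 0 then dirac m else normal_prob m (Num.sqrt v).

(* Z ~ N(m, V), for V symmetric positive semidefinite and possibly singular:
   every linear combination a'Z has the univariate law N(a'm, a'Va). *)
Definition normal_vector (R : realType) (d : measure_display)
    (T : measurableType d) (P : probability T R) (q : nat)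
    (Z : T -> 'cV[R]_q) (m : 'cV[R]_q) (V : 'M[R]_q) : Prop :=
  random_vector Z /\
  forall (a : 'cV[R]_q) (A : set R), measurable A ->
    P ((fun w => mx11_val (a^T *m Z w)) @^-1` A) =
    normal_law (mx11_val (a^T *m m)) (mx11_val (a^T *m V *m a)) A.

(* Convergence in distribution of random vectors; the n-th vector may live on
   its own probability space. *)
Definition cvg_in_distribution (R : realType) (q : nat)
    (d : nat -> measure_display) (T : forall n, measurableType (d n))
    (P : forall n, probability (T n) R) (Z : forall n, T n -> 'cV[R]_q)
    (d' : measure_display) (T' : measurableType d') (P' : probability T' R)
    (Z' : T' -> 'cV[R]_q) : Prop :=
  forall f : 'cV[R]_q -> R,
    continuous f -> (exists M : R, forall x, `|f x| <= M) ->
    'E_(P n)[f \o Z n]%E @[n --> \oo] --> 'E_P'[f \o Z']%E.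

Definition is_minimizer (R : realType) (q : nat) (f : 'cV[R]_q -> R)
    (x : 'cV[R]_q) : Prop :=
  forall y, f x <= f y.

(* Meaningful when the minimizer exists and is unique. *)
Definition argmin (R : realType) (q : nat) (f : 'cV[R]_q -> R) : 'cV[R]_q :=
  xget 0 [set x | is_minimizer f x].

(* Phi(z, m, s), with s the standard deviation *)
Definition normal_cdf (R : realType) (z m s : R) : R :=
  fine (normal_prob m s `]-oo, z]).

Definition penalized_rss (R : realType) (n p : nat) (X : 'M[R]_(n, p))
    (y : 'cV[R]_n) (lambda s : R) (b : 'cV[R]_p) : R :=
  mx11_val ((y - X *m b)^T *m (y - X *m b)) +
  lambda * \sum_(i < p)
    b i ord0 * (2 * normal_cdf (b i ord0 / s) 0 (Num.sqrt 2)^-1 - 1).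

Definition limit_objective (R : realType) (p : nat) (beta : 'cV[R]_p)
    (Sigma : 'M[R]_p) (lambda0 : R) (W u : 'cV[R]_p) : R :=
  - 2 * mx11_val (u^T *m W) + mx11_val (u^T *m Sigma *m u) +
  lambda0 * \sum_(i < p)
    (u i ord0 * Num.sg (beta i ord0) * (beta i ord0 != 0)%:R
     + `|u i ord0| * (beta i ord0 == 0)%:R).

(* Main.v *)
Require Import Defs.
From HB Require Import structures.
From mathcomp Require Import all_boot all_order all_algebra.
From mathcomp Require Import all_classical all_reals all_analysis.
From mathcomp Require Import measurable_realfun ring lra.

Set Implicit Arguments.
Unset Strict Implicit.
Unset Printing Implicit Defensive.

Import Order.TTheory GRing.Theory Num.Theory.
Import numFieldNormedType.Exports.

Local Open Scope classical_set_scope.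
Local Open Scope ring_scope.

(** Write [r = sqrt n], [W_n = X' e / r], [C_n = X' X / n] and [u = r (b - beta)].
    Then [W_n] is Gaussian with covariance [sigma^2 C_n].  Since
    [|b (2 Phi(b / s) - 1) - |b|| <= K s] uniformly in [b] and [lambda_n s_n -> 0],
    the penalized criterion is, up to a vanishing error uniform in [u], the lasso
    criterion [u' C_n u - 2 u' W_n + lambda_n / r * sum (|r beta_i + u_i| - |r beta_i|)].
    The limit objective [k_W] is strongly convex, so its minimizer [A(W)] is a
    Lipschitz function of [W]; comparing values at the two minimizers shows,
    deterministically and uniformly for [W_n] in a box, that the rescaled
    estimator is eventually close to [A(W_n)].

    It remains to see that [W_n] converges in distribution.  The hypotheses only
    give the laws of the projections [a' W_n], hence the limits of the
    expectations of cosines [cos (a' W_n + b)] and tightness.  Composing tensor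
    Bernstein polynomials with [x_i |-> (1 + sin (x_i / L)) / 2] shows that linear
    combinations of such cosines approximate any bounded continuous function
    uniformly on a box without exceeding its bound outside of it. *)

(** * Compactness of boxes *)

Lemma cvgr_sum (R : realType) (T I : Type) (F : set_system T) {FF : Filter F}
    (r : seq I) (f : I -> T -> R) (l : I -> R) :
  (forall i, f i x @[x --> F] --> l i) ->
  \sum_(i <- r) f i x @[x --> F] --> \sum_(i <- r) l i.
Proof.
move=> fl; elim: r => [|i r IH].
  by rewrite big_nil; under eq_fun do rewrite big_nil; exact: cvg_cst.
by rewrite big_cons; under eq_fun do rewrite big_cons; exact: cvgD.
Qed.

Section Box.
Context (R : realType) (p : nat).
Implicit Types (x y : 'cV[R]_p) (M : R).

Definition box M : set 'cV[R]_p := [set x | forall i, `|x i ord0| <= M].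

Lemma trmx_continuous m n : continuous (trmx : 'M[R]_(m, n) -> 'M[R]_(n, m)).
Proof.
move=> A B [Q nQ QB]; exists (fun i j => Q j i) => [i j|C CQ].
  by have := nQ j i; rewrite mxE.
by apply: QB => i j; rewrite mxE; exact: CQ.
Qed.

(** Tychonoff is applied to row vectors, where the box is a product of segments, and the result is
    carried to columns by the continuous transposition. *)
Lemma box_compact M : compact (box M).
Proof.
have -> : box M = trmx @` [set v : 'rV[R]_p | forall i, v ord0 i \in `[- M, M]].
  apply/seteqP; split => [x xM|_ [v vM <-] i].
    exists (x^T); last by rewrite trmxK.
    by move=> i; rewrite mxE in_itv/= -ler_norml.
  by have := vM i; rewrite mxE in_itv/= -ler_norml.
apply: continuous_compact; last first.
  apply: (@rV_compact _ _ (fun=> `[(- M), M]%classic)) => i.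
  exact: segment_compact.
by apply: continuous_subspaceT; exact: trmx_continuous.
Qed.

Lemma continuous_box_bounded (f : 'cV[R]_p -> R) M : continuous f ->
  exists B, forall x, box M x -> `|f x| <= B.
Proof.
move=> cf; have : compact (f @` box M).
  exact: (continuous_compact (continuous_subspaceT cf) (@box_compact M)).
move=> /compact_bounded[B [_ fB]]; exists (B + 1) => x xM.
by apply: (fB (B + 1)); [rewrite ltrDl|exists x].
Qed.

Lemma continuous_box_unif (f : 'cV[R]_p -> R) M (e : R) : continuous f -> 0 < e ->
  exists2 d, 0 < d & forall x y, box M x -> box M y ->
    (forall i, `|x i ord0 - y i ord0| < d) -> `|f x - f y| <= e.
Proof.
move=> cf e0.
have e20 : 0 < e / 2 by rewrite divr_gt0.
have /compact_near_coveringP bc := @box_compact M.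
have := bc _ (nbhs (0 : R)^'+) (fun d x => forall y, `|x - y| < d -> `|f x - f y| <= e).
case.
  move=> x xM.
  have /cvgrPdist_lt/(_ _ e20) := cf x.
  move=> /nbhs_ballP[r /= r0 xr].
  (* Halving the radius keeps both [x'] and any [y] within [d < r / 2] of it inside the ball of
     radius [r] around [x], so one [d] serves a whole neighbourhood and compactness makes it
     uniform. *)
  exists (ball x (r / 2), [set d | d < r / 2]) => /=.
    split; first by apply: nbhsx_ballx; rewrite divr_gt0.
    by apply: nbhs_right_lt; rewrite divr_gt0.
  move=> [x' d]/= [xx' dr] y x'y.
  have h1 : `|f x - f x'| < e / 2.
    by apply: xr; apply: le_ball xx'; rewrite ler_pdivrMr// ler_peMr ?ltW// ltr1n.
  have h2 : `|f x - f y| < e / 2.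
    apply: xr; rewrite [r]splitr; apply: ball_triangle xx' _.
    by rewrite -ball_normE/=; exact: lt_trans dr.
  rewrite (le_trans (ler_distD (f x) _ _))// [e]splitr lerD// ?ltW//.
  by rewrite distrC.
move=> d /= d0 H.
exists (d / 2); first by rewrite divr_gt0.
move=> x y xM yM xy; apply: (H (d / 2)) => //=.
- by rewrite /ball_ /= sub0r normrN gtr0_norm ?divr_gt0// ltr_pdivrMr// ltr_pMr// ltr1n.
- by rewrite divr_gt0.
- have : ball x (d / 2) y.
    by split; [rewrite divr_gt0|move=> i j; rewrite -ball_normE/= ord1; exact: xy].
  by rewrite -ball_normE.
Qed.

(** Only the value at the minimizer is recorded, not its membership in the box: coercivity later
    compares this value with those outside the box. *)
Lemma continuous_box_min (f : 'cV[R]_p -> R) M : 0 <= M -> continuous f ->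
  exists x, forall y, box M y -> f x <= f y.
Proof.
move=> M0 cf; have [] := @compact_EVT_min _ _ f (box M).
- by exists 0 => i; rewrite mxE normr0.
- exact: box_compact.
- exact: continuous_subspaceT.
- by move=> x _ fx; exists x => y yM; apply: fx; rewrite inE.
Qed.

End Box.

(** * Bernstein weights and trigonometric approximation *)

Section Bernstein.
Context (R : realType).
Implicit Types (t : R) (N k : nat).

(* ['C(N, k) t ^ k (1 - t) ^ (N - k)], defined by Pascal's rule *)
Fixpoint bernstein N k t : R :=
  if N is N'.+1 then
    (1 - t) * bernstein N' k t + (if k is k'.+1 then t * bernstein N' k' t else 0)
  else (k == 0)%N%:R.

Arguments bernstein : simpl never.

Lemma bernstein0n k t : bernstein 0 k t = (k == 0)%N%:R.
Proof. by []. Qed.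

Lemma bernsteinSn N k t : bernstein N.+1 k t =
  (1 - t) * bernstein N k t + (if k is k'.+1 then t * bernstein N k' t else 0).
Proof. by []. Qed.

Lemma bernstein_ge0 N k t : 0 <= t <= 1 -> 0 <= bernstein N k t.
Proof.
move=> /andP[t0 t1]; elim: N k => [|N IH] [|k]; rewrite ?bernstein0n ?bernsteinSn//.
  by rewrite addr0 mulr_ge0 ?subr_ge0.
by rewrite addr_ge0 // mulr_ge0 ?subr_ge0.
Qed.

Lemma bernstein_gt N k t : (N < k)%N -> bernstein N k t = 0.
Proof.
elim: N k => [|N IH] [|k]// Nk; rewrite bernsteinSn.
by rewrite !IH ?mulr0 ?addr0// ltnW.
Qed.

(** Conditioning on one trial: if [S] is binomial with [N] trials, one more trial leaves [S] with
    probability [1 - t] and raises it to [S + 1] with probability [t]. *)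
Lemma sum_bernsteinS N t (g : nat -> R) :
  \sum_(k < N.+2) bernstein N.+1 k t * g k =
  (1 - t) * \sum_(k < N.+1) bernstein N k t * g k +
  t * \sum_(k < N.+1) bernstein N k t * g k.+1.
Proof.
under eq_bigr do rewrite bernsteinSn mulrDl; rewrite big_split/=; congr (_ + _).
  rewrite big_ord_recr/= bernstein_gt// mulr0 mul0r addr0 mulr_sumr.
  by apply: eq_bigr => k _; rewrite mulrA.
rewrite big_ord_recl/= mul0r add0r mulr_sumr.
by apply: eq_bigr => k _; rewrite /= add0n mulrA.
Qed.

Lemma sum_bernstein N t : \sum_(k < N.+1) bernstein N k t = 1.
Proof.
under eq_bigr do rewrite -[bernstein _ _ _]mulr1.
elim: N => [|N IH]; first by rewrite big_ord1 bernstein0n /= mulr1.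
by rewrite (sum_bernsteinS N t (fun=> 1)) IH !mulr1 subrK.
Qed.

(** Squared bias plus binomial variance. The centre [a] is arbitrary because the induction step
    shifts it to [a - 1]. *)
Lemma bernstein_second_moment N t a :
  \sum_(k < N.+1) bernstein N k t * (k%:R - a) ^+ 2 =
  (N%:R * t - a) ^+ 2 + N%:R * (t * (1 - t)).
Proof.
elim: N a => [|N IH] a.
  by rewrite big_ord1 bernstein0n /= mul1r !mul0r addr0.
rewrite (sum_bernsteinS N t (fun k => (k%:R - a) ^+ 2)) IH.
under [X in _ + t * X]eq_bigr => k _.
  have -> : (k.+1%:R - a) = (k%:R - (a - 1)) by rewrite -natr1; ring.
  over.
by rewrite IH -natr1; ring.
Qed.

Lemma bernstein_variance N t : 0 <= t <= 1 ->
  \sum_(k < N.+2) bernstein N.+1 k t * (k%:R / N.+1%:R - t) ^+ 2 <= N.+1%:R^-1.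
Proof.
move=> /andP[t0 t1].
have N0 : N.+1%:R != 0 :> R by rewrite pnatr_eq0.
under eq_bigr => k _.
  have -> : k%:R / N.+1%:R - t = (k%:R - N.+1%:R * t) / N.+1%:R by field.
  rewrite expr_div_n mulrA; over.
rewrite -mulr_suml bernstein_second_moment subrr expr0n/= add0r.
rewrite ler_pdivrMr ?exprn_gt0// (_ : _^-1 * _ = N.+1%:R); last by field.
rewrite ler_piMr// mulr_ile1// ?subr_ge0//.
by rewrite gerBl.
Qed.

(** For [t i] in the unit interval, this is the joint law of [p] independent binomial counts with
    success probabilities [t i]. *)
Definition bernstein_tensor p N (k : {ffun 'I_p -> 'I_N.+1}) (t : 'I_p -> R) : R :=
  \prod_i bernstein N (k i) (t i).

Lemma sum_bernstein_tensor p N (t : 'I_p -> R) :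
  \sum_(k : {ffun 'I_p -> 'I_N.+1}) bernstein_tensor k t = 1.
Proof.
rewrite /bernstein_tensor.
rewrite -(bigA_distr_bigA (fun i (k : 'I_N.+1) => bernstein N k (t i))).
by rewrite big1// => i _; exact: sum_bernstein.
Qed.

(** The factor [g] is absorbed into coordinate [i0] of the product; distributivity then factors the
    sum, and every other coordinate has total mass 1. *)
Lemma sum_bernstein_tensor_marginal p N (t : 'I_p -> R) i0 (g : nat -> R) :
  \sum_(k : {ffun 'I_p -> 'I_N.+1}) bernstein_tensor k t * g (k i0) =
  \sum_(k < N.+1) bernstein N k (t i0) * g k.
Proof.
rewrite /bernstein_tensor.
transitivity (\sum_(k : {ffun 'I_p -> 'I_N.+1})
    \prod_i (bernstein N (k i) (t i) * (if i == i0 then g (k i) else 1))).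
  apply: eq_bigr => k _; rewrite big_split/=; congr (_ * _).
  by rewrite -big_mkcond/= big_pred1_eq.
rewrite -(bigA_distr_bigA
  (fun i (k : 'I_N.+1) => bernstein N k (t i) * (if i == i0 then g k else 1))).
rewrite (bigD1 i0)//= eqxx [X in _ * X]big1 ?mulr1// => i /negPf ii0.
rewrite ii0; under eq_bigr do rewrite mulr1.
exact: sum_bernstein.
Qed.

End Bernstein.

(** * Approximation by uniformly bounded trigonometric polynomials *)

Section TrigPoly.
Context (R : realType) (p : nat).
Implicit Types f g : 'cV[R]_p -> R.

(** The phase [b] provides sines and constants. Keeping only sums of cosines of projections makes
    convergence of their expectations immediate; closure under products is proved below. *)
Inductive trig_poly : ('cV[R]_p -> R) -> Prop :=
| trig_poly_cos c a b : trig_poly (fun x => c * cos (mx11_val (a^T *m x) + b))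
| trig_poly_add f g : trig_poly f -> trig_poly g ->
    trig_poly (fun x => f x + g x).

Lemma trig_poly_cst c : trig_poly (fun=> c).
Proof.
have := trig_poly_cos c 0 0; congr trig_poly; apply/funext => x.
by rewrite trmx0 mul0mx /mx11_val mxE addr0 cos0 mulr1.
Qed.

(** Product-to-sum formula: [2 cos u cos v = cos (u + v) + cos (u - v)]. *)
Lemma trig_poly_mul f g : trig_poly f -> trig_poly g ->
  trig_poly (fun x => f x * g x).
Proof.
move=> tf; elim: tf g => {f} [c a b g tg|f1 f2 _ IH1 _ IH2 g tg]; last first.
  have := trig_poly_add (IH1 _ tg) (IH2 _ tg); congr trig_poly.
  by apply/funext => x; rewrite mulrDl.
elim: tg => {g} [c' a' b'|g1 g2 _ IH1 _ IH2]; last first.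
  have := trig_poly_add IH1 IH2; congr trig_poly.
  by apply/funext => x; rewrite mulrDr.
have := trig_poly_add (trig_poly_cos (c * c' / 2) (a + a') (b + b'))
  (trig_poly_cos (c * c' / 2) (a - a') (b - b')).
congr trig_poly; apply/funext => x.
rewrite linearD linearB/= mulmxDl mulmxBl /mx11_val !mxE.
set u := (\sum_j _); set v := (\sum_j _).
rewrite (_ : u + v + (b + b') = (u + b) + (v + b')); last by ring.
rewrite (_ : u - v + (b - b') = (u + b) - (v + b')); last by ring.
by rewrite (cosB (u + b)) (cosD (u + b)); field.
Qed.

Lemma trig_poly_sum (I : Type) (s : seq I) (F : I -> 'cV[R]_p -> R) :
  (forall i, trig_poly (F i)) -> trig_poly (fun x => \sum_(i <- s) F i x).
Proof.
move=> tF; elim: s => [|i s IH].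
  by under eq_fun do rewrite big_nil; exact: trig_poly_cst.
by under eq_fun do rewrite big_cons; exact: trig_poly_add.
Qed.

Lemma trig_poly_prod (I : Type) (s : seq I) (F : I -> 'cV[R]_p -> R) :
  (forall i, trig_poly (F i)) -> trig_poly (fun x => \prod_(i <- s) F i x).
Proof.
move=> tF; elim: s => [|i s IH].
  by under eq_fun do rewrite big_nil; exact: trig_poly_cst.
by under eq_fun do rewrite big_cons; exact: trig_poly_mul.
Qed.

Lemma trig_poly_bernstein N k f : trig_poly f ->
  trig_poly (fun x => bernstein N k (f x)).
Proof.
move=> tf; elim: N k => [|N IH] k; first exact: trig_poly_cst.
under eq_fun do rewrite bernsteinSn.
apply: trig_poly_add.
  apply: trig_poly_mul => //.
  under eq_fun do rewrite -mulN1r.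
  apply: trig_poly_add; first exact: trig_poly_cst.
  by apply: trig_poly_mul => //; exact: trig_poly_cst.
by case: k => [|k]; [exact: trig_poly_cst|exact: trig_poly_mul].
Qed.

(** A periodic map into the unit interval, so Bernstein weights stay nonnegative on the whole space;
    it is injective for [|x| <= L], where [|x / L| <= 1 < pi / 2]. *)
Definition half_sin (L x : R) : R := (1 + sin (x / L)) / 2.

Lemma half_sin01 L x : 0 <= half_sin L x <= 1.
Proof. by rewrite /half_sin; have := sin_geN1 (x / L); have := sin_le1 (x / L); lra. Qed.

Lemma trig_poly_half_sin L i : trig_poly (fun x => half_sin L (x i ord0)).
Proof.
have := trig_poly_add (trig_poly_cst (1 / 2))
  (trig_poly_cos (1 / 2) (L^-1 *: delta_mx i ord0) (- (pi / 2))).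
congr trig_poly; apply/funext => x; rewrite /half_sin.
rewrite linearZ/= trmx_delta -scalemxAl -rowE /mx11_val !mxE.
by rewrite -sinDpihalf subrK [L^-1 * _]mulrC; field.
Qed.

Lemma ler_sin (x y : R) : - (pi / 2) <= x -> y <= pi / 2 -> x <= y ->
  sin x <= sin y.
Proof.
move=> x1 y1; rewrite le_eqVlt => /predU1P[->//|xy].
by rewrite ltW// ltr_sin// in_itv/=; lra.
Qed.

(** With half-difference [h] and midpoint [m], the difference is [2 cos m sin h]. Since
    [|m| <= pi / 2 - h], [cos m] is at least [sin h], which is at least [sin (d / 2)]. *)
Lemma sin_separated (d a b : R) : 0 < d -> - (pi / 2) <= b -> a <= pi / 2 ->
  d <= a - b -> 2 * sin (d / 2) ^+ 2 <= sin a - sin b.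
Proof.
move=> d0 bpi api dab.
pose h := (a - b) / 2; pose m := (a + b) / 2.
have -> : a = m + h by rewrite /m /h; field.
have -> : b = m - h by rewrite /m /h; field.
rewrite sinD sinB.
have pi0 := pi_gt0 R.
have hpi : h <= pi / 2 by rewrite /h; lra.
have dh : d / 2 <= h by rewrite /h; lra.
have sd0 : 0 <= sin (d / 2) by apply: sin_ge0_pi; lra.
have sdh : sin (d / 2) <= sin h by apply: ler_sin; lra.
have sc : sin h <= cos m.
  have m0 : 0 <= `|m| by [].
  have mh : `|m| <= pi / 2 - h by rewrite ler_norml /m /h; lra.
  by rewrite -cos_norm -[`|m|]opprK cosN -sinDpihalf; apply: ler_sin; lra.
rewrite (_ : _ - _ = 2 * (cos m * sin h)); last by ring.
by rewrite ler_pM2l// expr2 ler_pM// (le_trans sdh sc).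
Qed.

(** Bernstein's argument in the variables [half_sin L (x i)]: [T] is a weighted average of values of
    [f] at nodes, hence bounded by [M] everywhere, and Chebyshev's inequality controls the nodes far
    from [x]. *)
Lemma trig_poly_approx f (M L e : R) : continuous f -> 0 < L -> 0 < e ->
  (forall x, box (2 * L) x -> `|f x| <= M) ->
  exists T, [/\ trig_poly T, forall x, `|T x| <= M &
    forall x, box L x -> `|T x - f x| <= e].
Proof.
move=> cf L0 e0 fM.
have [d d0 fd] := continuous_box_unif (2 * L) cf (divr_gt0 e0 (ltr0n R 2)).
(* [kap] bounds from below the [half_sin] separation of a node and a point of the box whose
   coordinates differ by at least [d]. The minimum with 1 keeps the angle where the sine is
   positive. *)
have [kap [kap0 kapE]] :
    exists kap : R, 0 < kap /\ sin (Num.min (d / L) 1 / 2) ^+ 2 = kap.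
  eexists; split; last by [].
  have m0 : 0 < Num.min (d / L) 1 by rewrite lt_min ltr01 divr_gt0.
  have m1 : Num.min (d / L) 1 <= 1 by rewrite ge_min lexx orbT.
  by rewrite exprn_gt0// sin_gt0_pi//; have := pi_ge2 R; lra.
have M0 : 0 <= M.
  by apply: le_trans (fM 0 _) => // i; rewrite mxE normr0; lra.
pose C : R := 2 * M / kap ^+ 2.
have C0 : 0 <= C by apply: divr_ge0; [exact: mulr_ge0|apply: exprn_ge0; exact: ltW].
(* Chosen so that [p] coordinates, each with variance at most [1 / N.+1], cost at most [e / 2] after
   multiplication by [C]. *)
pose N := Num.truncn (2 * C * p%:R / e).
have NC : C * p%:R / N.+1%:R <= e / 2.
  rewrite ler_pdivrMr// -ler_pdivrMl ?divr_gt0//.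
  apply: le_trans (ltW (truncnS_gt _)); rewrite le_eqVlt; apply/orP; left.
  by apply/eqP; field; rewrite gt_eqF.
(* Preimages under [half_sin L] of the grid points [k i / N.+1]. As [asin] is at most [pi / 2 < 2]
   in absolute value, they lie in the box of radius [2 * L], where [f] is bounded by [M]. *)
pose node (k : {ffun 'I_p -> 'I_N.+2}) : 'cV[R]_p :=
  \col_i (L * asin (2 * ((k i)%:R / N.+1%:R) - 1)).
pose T (x : 'cV[R]_p) := \sum_(k : {ffun 'I_p -> 'I_N.+2})
  f (node k) * bernstein_tensor k (fun i => half_sin L (x i ord0)).
have k01 (k : 'I_N.+2) : 0 <= (k%:R / N.+1%:R : R) <= 1.
  by rewrite divr_ge0//= ler_pdivrMr// mul1r ler_nat -ltnS.
have nodepi k i : [/\ node k i ord0 = L * asin (2 * ((k i)%:R / N.+1%:R) - 1),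
   - (pi / 2) <= asin (2 * ((k i)%:R / N.+1%:R) - 1) :> R &
   asin (2 * ((k i)%:R / N.+1%:R) - 1) <= pi / 2 :> R].
  have k1 := k01 (k i); split; first by rewrite mxE.
    by apply: asin_geNpi2; move: k1; set r := _ / _ => k1; lra.
  by apply: asin_lepi2; move: k1; set r := _ / _ => k1; lra.
have nodeL k : box (2 * L) (node k).
  move=> i; have [-> h1 h2] := nodepi k i.
  rewrite normrM gtr0_norm// mulrC ler_wpM2r ?(ltW L0)//.
  have := pihalf_lt2 R; rewrite ler_norml; lra.
have w0 (k : {ffun 'I_p -> 'I_N.+2}) (x : 'cV[R]_p) :
    0 <= bernstein_tensor k (fun i => half_sin L (x i ord0)).
  by apply: prodr_ge0 => i _; apply: bernstein_ge0; exact: half_sin01.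
exists T; split.
- apply: trig_poly_sum => k; apply: trig_poly_mul; first exact: trig_poly_cst.
  apply: trig_poly_prod => i; apply: trig_poly_bernstein.
  exact: trig_poly_half_sin.
- move=> x; apply: le_trans (ler_norm_sum _ _ _) _.
  rewrite -[M]mulr1 -(sum_bernstein_tensor N.+1 (fun i => half_sin L (x i ord0))).
  rewrite mulr_sumr; apply: ler_sum => k _.
  rewrite normrM [`|bernstein_tensor _ _|]ger0_norm// ler_wpM2r//.
  exact: fM.
- move=> x xL.
  have xL2 : box (2 * L) x by move=> i; rewrite (le_trans (xL i))//; lra.
  (* Near nodes cost [e / 2] by uniform continuity. At a far node some coordinate has squared
     deviation at least [kap ^+ 2], so its quadratic term alone exceeds the trivial bound
     [2 * M]. *)
  have key k : `|f (node k) - f x| <=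
      e / 2 + \sum_i C * ((k i)%:R / N.+1%:R - half_sin L (x i ord0)) ^+ 2.
    have S0 (P : pred 'I_p) : 0 <= \sum_(i | P i)
        C * ((k i)%:R / N.+1%:R - half_sin L (x i ord0)) ^+ 2.
      by apply: sumr_ge0 => i _; rewrite mulr_ge0// sqr_ge0.
    have [/forallP kd|] :=
        boolP [forall i, `|node k i ord0 - x i ord0| < d].
      by rewrite (le_trans (fd _ _ (nodeL k) xL2 kd))// lerDl.
    rewrite negb_forall => /existsP[i]; rewrite -leNgt => kid.
    rewrite (bigD1 i)//=.
    have h1 : `|f (node k) - f x| <= 2 * M.
      rewrite (le_trans (ler_normB _ _))// mulr_natl mulr2n.
      by rewrite lerD// fM.
    have h2 : 2 * M <= C * ((k i)%:R / N.+1%:R - half_sin L (x i ord0)) ^+ 2.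
      rewrite /C mulrAC ler_pdivlMr ?exprn_gt0// ler_wpM2l ?mulr_ge0//.
      rewrite -[leRHS]real_normK ?num_real// ler_sqr ?nnegrE ?(ltW kap0)//.
      have [nE n1 n2] := nodepi k i.
      rewrite /half_sin; set a := asin _ in nE n1 n2.
      have aE : (k i)%:R / N.+1%:R = (1 + sin a) / 2.
        rewrite /a asinK; first by field.
        by have := k01 (k i); set r := _ / _ => k1; rewrite in_itv/=; lra.
      rewrite aE (_ : _ - _ = (sin a - sin (x i ord0 / L)) / 2); last by field.
      have xLi : `|x i ord0 / L| <= 1.
        by rewrite normrM normfV (gtr0_norm L0) ler_pdivrMr// mul1r.
      have dL : Num.min (d / L) 1 <= `|a - x i ord0 / L|.
        rewrite ge_min; apply/orP; left; rewrite ler_pdivrMr// -[X in _ * X]gtr0_norm//.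
        rewrite -normrM mulrBl divfK ?gt_eqF// mulrC.
        by rewrite -nE.
      have m0 : 0 < Num.min (d / L) 1 by rewrite lt_min ltr01 divr_gt0.
      have := pi_ge2 R => pi2.
      move: xLi; rewrite ler_norml => xLi.
      have [ax|ax] := leP (x i ord0 / L) a.
        have := @sin_separated (Num.min (d / L) 1) a (x i ord0 / L) m0.
        rewrite ger0_norm ?subr_ge0// in dL.
        have : sin (x i ord0 / L) <= sin a by apply: ler_sin; lra.
        move=> s1 /(_ ltac:(lra) ltac:(lra) ltac:(lra)).
        by rewrite kapE ger0_norm; lra.
      have := @sin_separated (Num.min (d / L) 1) (x i ord0 / L) a m0.
      rewrite distrC ger0_norm ?subr_ge0 ?(ltW ax)// in dL.
      have : sin a <= sin (x i ord0 / L) by apply: ler_sin; lra.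
      move=> s1 /(_ ltac:(lra) ltac:(lra) ltac:(lra)).
      by rewrite kapE ler0_norm; lra.
    rewrite (le_trans h1)// (le_trans h2)// addrCA lerDl addr_ge0 ?S0//.
    by rewrite ltW// divr_gt0.
  have -> : T x - f x = \sum_(k : {ffun 'I_p -> 'I_N.+2})
      (f (node k) - f x) * bernstein_tensor k (fun i => half_sin L (x i ord0)).
    rewrite -[f x in LHS]mulr1.
    rewrite -(sum_bernstein_tensor N.+1 (fun i => half_sin L (x i ord0))).
    by rewrite mulr_sumr -sumrB; apply: eq_bigr => k _; rewrite mulrBl.
  apply: le_trans (ler_norm_sum _ _ _) _.
  apply: (@le_trans _ _ (\sum_(k : {ffun 'I_p -> 'I_N.+2})
     (e / 2 * bernstein_tensor k (fun i => half_sin L (x i ord0)) +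
      \sum_i C * (bernstein_tensor k (fun i => half_sin L (x i ord0)) *
        ((k i)%:R / N.+1%:R - half_sin L (x i ord0)) ^+ 2)))).
    apply: ler_sum => k _; rewrite normrM.
    rewrite [`|bernstein_tensor _ _|]ger0_norm//.
    have /le_trans := ler_wpM2r (w0 k x) (key k); apply.
    rewrite mulrDl lerD2l mulr_suml; apply: ler_sum => i _.
    by rewrite -mulrA [X in C * X]mulrC.
  rewrite big_split/= -mulr_sumr sum_bernstein_tensor mulr1 exchange_big/=.
  rewrite [leRHS]splitr lerD2l.
  apply: le_trans NC.
  apply: (@le_trans _ _ (\sum_(i < p) C * N.+1%:R^-1)).
    apply: ler_sum => i _; rewrite -mulr_sumr ler_wpM2l//.
    rewrite (sum_bernstein_tensor_marginal N.+1 (fun i => half_sin L (x i ord0)) i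
      (fun k => (k%:R / N.+1%:R - half_sin L (x i ord0)) ^+ 2)).
    exact/bernstein_variance/half_sin01.
  by rewrite sumr_const card_ord -[X in X <= _]mulr_natr mulrAC.
Qed.

End TrigPoly.

(** * Random vectors *)

Section RandomVector.
Context (R : realType) (p : nat) (d : measure_display) (T : measurableType d).
Variable Z : T -> 'cV[R]_p.
Hypothesis mZ : random_vector Z.

Lemma measurable_mx11_dot (a : 'cV[R]_p) :
  measurable_fun setT (fun w => mx11_val (a^T *m Z w)).
Proof.
rewrite /mx11_val; under eq_fun do rewrite mxE.
apply: measurable_sum => i; apply: measurable_funM; first exact: measurable_cst.
exact: mZ.
Qed.

Lemma measurable_trig_poly (f : 'cV[R]_p -> R) : trig_poly f ->
  measurable_fun setT (f \o Z).
Proof.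
elim => {f} [c a b|f g _ mf _ mg]; last exact: measurable_funD.
apply: measurable_funM; first exact: measurable_cst.
apply: (measurableT_comp (f := @cos R)).
  by apply: continuous_measurable_fun; exact: continuous_cos.
apply: measurable_funD; first exact: measurable_mx11_dot.
exact: measurable_cst.
Qed.

(** [Z] is measurable only coordinatewise, so [f \o Z] is written as a pointwise limit of
    trigonometric polynomials in [Z], close to [f] on growing boxes. *)
Lemma measurable_continuous_comp (f : 'cV[R]_p -> R) : continuous f ->
  measurable_fun setT (f \o Z).
Proof.
move=> cf.
have /choice[F FP] (n : nat) : exists F, trig_poly F /\
    forall x, box n.+1%:R x -> `|F x - f x| <= n.+1%:R^-1.
  have [M fM] := continuous_box_bounded (2 * n.+1%:R) cf.
  have [|F [tF _ Ff]] := @trig_poly_approx _ _ f M n.+1%:R n.+1%:R^-1 cf (ltr0Sn _ _) _ fM.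
    by rewrite invr_gt0.
  by exists F.
apply: (@measurable_fun_cvg _ _ _ setT (fun n => F n \o Z)).
  by move=> n; exact: measurable_trig_poly (FP n).1.
move=> w _ /=.
pose M := \sum_i `|Z w i ord0|.
have ZM : box M (Z w).
  by move=> i; rewrite /M (bigD1 i)//= lerDl sumr_ge0.
apply/cvgrPdist_le => e e0; near=> n; rewrite distrC.
have nM : M <= n.+1%:R.
  rewrite (@le_trans _ _ n%:R) ?ler_nat//.
  by near: n; exact: nbhs_infty_ger.
rewrite (le_trans ((FP n).2 _ _))//; first by move=> i; exact: le_trans (ZM i) nM.
rewrite invf_ple ?posrE// (@le_trans _ _ n%:R) ?ler_nat//.
by near: n; exact: nbhs_infty_ger.
Unshelve. all: by end_near. Qed.

End RandomVector.

(** * Expectations and normal laws *)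

Section BoundedExpectation.
Context (R : realType) (d : measure_display) (T : measurableType d).
Variable P : probability T R.
Implicit Types X Y : T -> R.

Lemma bounded_integrable X (M : R) : measurable_fun setT X ->
  (forall w, `|X w| <= M) -> P.-integrable setT (EFin \o X).
Proof.
move=> mX XM; apply: measurable_bounded_integrable => //.
- by rewrite (le_lt_trans (probability_le1 _ _)) ?ltry.
- exists M; split; first exact: num_real.
  by move=> r Mr w _ /=; rewrite (le_trans (XM w))// ltW.
Qed.

Lemma expectation_Rintegral X (M : R) : measurable_fun setT X ->
  (forall w, `|X w| <= M) -> 'E_P[X]%E = (\int[P]_w X w)%:E.
Proof.
move=> mX XM; rewrite unlock /Rintegral fineK//.
by apply: integrable_fin_num => //; exact: bounded_integrable XM.
Qed.

Lemma Rintegral_prob_cst (c : R) : \int[P]_w c = c.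
Proof. by rewrite Rintegral_cst//= probability_setT mulr1. Qed.

Lemma Rintegral_prob_addr X (M c : R) : measurable_fun setT X ->
  (forall w, `|X w| <= M) -> \int[P]_w (X w + c) = \int[P]_w X w + c.
Proof.
move=> mX XM; rewrite -[X in _ = _ + X]Rintegral_prob_cst.
rewrite -(RintegralD measurableT (bounded_integrable mX XM))//.
exact: (@bounded_integrable _ `|c|).
Qed.

(** The integrand [|X - Y|] is dominated by [e + 2 * M * \1_A]. *)
Lemma Rintegral_dist_le X Y (A : set T) (M e : R) :
  measurable_fun setT X -> measurable_fun setT Y -> measurable A ->
  (forall w, `|X w| <= M) -> (forall w, `|Y w| <= M) -> 0 <= e ->
  (forall w, ~ A w -> `|X w - Y w| <= e) ->
  `|\int[P]_w X w - \int[P]_w Y w| <= e + 2 * M * fine (P A).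
Proof.
move=> mX mY mA XM YM e0 XYe.
have iX := bounded_integrable mX XM.
have iY := bounded_integrable mY YM.
have XY2 w : `|X w - Y w| <= 2 * M.
  by rewrite (le_trans (ler_normB _ _))// mulr_natl mulr2n lerD.
have mXY : measurable_fun setT (fun w => X w - Y w) by exact: measurable_funB.
rewrite -(RintegralB measurableT iX iY).
apply: (le_trans (le_normr_Rintegral measurableT (bounded_integrable mXY XY2))).
have M0 (w : T) : 0 <= M by exact: le_trans (normr_ge0 _) (XM w).
have mI : measurable_fun setT (fun w => e + 2 * M * \1_A w).
  apply: measurable_funD; first exact: measurable_cst.
  by apply: measurable_funM; [exact: measurable_cst|exact: measurable_indic].
have iA : P.-integrable setT (EFin \o (\1_A : T -> R)).
  apply: (@bounded_integrable _ 1) => // w.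
  by rewrite ger0_norm// indicE lern1; case: (_ \in _).
have iMA : P.-integrable setT (EFin \o (fun w => 2 * M * \1_A w)).
  apply: (@bounded_integrable _ (2 * `|M|)).
    by apply: measurable_funM; [exact: measurable_cst|exact: measurable_indic].
  move=> w; rewrite normrM normrM (ger0_norm (ler0n _ _)).
  rewrite ler_piMr ?mulr_ge0// indicE.
  by case: (_ \in _); rewrite ?normr0 ?normr1.
have -> : e + 2 * M * fine (P A) = \int[P]_w (e + 2 * M * \1_A w).
  rewrite RintegralD//; last first.
    by apply: (@bounded_integrable _ e) => // w; rewrite ger0_norm.
  rewrite Rintegral_prob_cst RintegralZl//; congr (_ + _ * _).
  by rewrite /Rintegral integral_indic// setIT.
apply: le_Rintegral => //.
- apply: (@bounded_integrable _ (2 * M)); first exact: measurableT_comp.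
  by move=> w; rewrite normr_id.
- apply: (@bounded_integrable _ (e + 2 * `|M|)) => // w.
  rewrite (le_trans (ler_normD _ _))// (ger0_norm e0) lerD2l.
  rewrite normrM normrM (ger0_norm (ler0n _ _)).
  rewrite ler_piMr ?mulr_ge0// indicE.
  by case: (_ \in _); rewrite ?normr0 ?normr1.
- move=> w _; have [Aw|Aw] := pselect (A w).
    by rewrite indicE mem_set// mulr1 (le_trans (XY2 w))// lerDr.
  by rewrite indicE memNset// mulr0 addr0 XYe.
Qed.

End BoundedExpectation.

Section NormalIntegral.
Context (R : realType).
Implicit Types (h : R -> R) (s v : R).
Local Notation mu := (@lebesgue_measure R).

(* [normal_pdf] is almost everywhere the Radon-Nikodym derivative. *)
Lemma integral_normal_prob (m s : R) (f : R -> \bar R) :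
  (normal_prob m s).-integrable setT f ->
  (\int[normal_prob m s]_x f x = \int[mu]_x (f x * (normal_pdf m s x)%:E))%E.
Proof.
move=> intf; have mf := measurable_int _ intf.
have dom := normal_prob_dominates m s.
rewrite -(Radon_Nikodym_change_of_variables dom)//.
have mpdf := measurable_normal_pdf m s.
apply: ae_eq_integral => //.
- exact: emeasurable_funM.
- by apply: emeasurable_funM => //; exact/measurable_EFinP.
- apply: ae_eqe_mul2l; apply: integral_ae_eq => //.
  + exact: Radon_Nikodym_integrable.
  + exact/measurable_EFinP.
  + by move=> E _ mE; rewrite -Radon_Nikodym_integral.
Qed.

Lemma normal_pdf_scale s x : 0 < s ->
  normal_pdf 0 s (s * x) * s = normal_pdf 0 1 x.
Proof.
move=> s0; rewrite !normal_pdfE ?gt_eqF//= /normal_peak /normal_fun.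
rewrite !subr0 mulrAC; congr (_ * _).
  rewrite expr1n mul1r -mulrnAr sqrtrM ?sqr_ge0// sqrtr_sqr gtr0_norm//.
  by rewrite invfM mulrAC mulVf ?mul1r// gt_eqF.
congr expR; rewrite exprMn expr1n; field.
by rewrite gt_eqF.
Qed.

Lemma normal_prob_scale s h (M : R) : 0 < s -> continuous h ->
  (forall x, `|h x| <= M) ->
  \int[normal_prob 0 s]_x h x = \int[normal_prob 0 1]_x h (s * x).
Proof.
move=> s0 ch hM.
have cs : continuous (fun x : R => s * x) by exact: mulrl_continuous.
have chs : continuous (fun x => h (s * x)).
  by move=> x; apply: continuous_comp; [exact: cs|exact: ch].
have mh : measurable_fun setT h by exact: continuous_measurable_fun.
have mhs : measurable_fun setT (fun x => h (s * x)).
  exact: continuous_measurable_fun.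
have ge0 x : 0 <= h x + M by have := hM x; rewrite ler_norml; lra.
have bM x : `|h x + M| <= 2 * M.
  by rewrite ger0_norm//; have := hM x; rewrite ler_norml; lra.
(* The substitution rule used is for nonnegative integrands; adding [M] makes [h] nonnegative and
   changes both sides equally. *)
suff : \int[normal_prob 0 s]_x (h x + M) =
       \int[normal_prob 0 1]_x (h (s * x) + M).
  rewrite (@Rintegral_prob_addr _ _ _ (normal_prob 0 s) h M M mh hM).
  by rewrite (@Rintegral_prob_addr _ _ _ (normal_prob 0 1) _ M M mhs
    (fun x => hM (s * x))) => /addIr.
rewrite /Rintegral !integral_normal_prob; last 2 first.
- apply: (@bounded_integrable _ _ _ _ _ (2 * M)) => //.
  by apply: measurable_funD => //; exact: measurable_cst.
- apply: (@bounded_integrable _ _ _ _ _ (2 * M)) => //.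
  by apply: measurable_funD => //; exact: measurable_cst.
congr fine.
have dF x : derivable (fun x : R => s * x) x 1.
  by apply: derivableM; [exact: derivable_cst|exact: derivable_id].
have F'E : (fun x : R => s * x)^`()%classic = cst s.
  by apply/funext => x; rewrite derive1Ml// derive1_id mulr1.
under eq_integral do rewrite -EFinM.
rewrite (@increasing_ge0_integration_by_substitutionT _ (fun x => s * x)).
- by apply: eq_integral => x _; rewrite F'E -[in RHS](normal_pdf_scale x s0) -EFinM mulrA.
- by move=> x y xy; rewrite ltr_pM2l.
- by rewrite F'E => x; exact: cvg_cst.
- by rewrite F'E; exact: is_cvg_cst.
- by rewrite F'E; exact: is_cvg_cst.
- exact: dF.
- by apply/gt0_cvgMrNy.
- by apply/gt0_cvgMry.
- move=> x; apply: cvgM; last by apply: continuous_normal_pdf; rewrite gt_eqF.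
  by apply: cvgD; [exact: ch|exact: cvg_cst].
- by move=> x; rewrite mulr_ge0// normal_pdf_ge0.
Qed.

Context (d : measure_display) (T : measurableType d).
Variable P : probability T R.

(** A centred normal variable has the law of [Num.sqrt v] times a standard one, including the point
    mass at [v = 0]. The variance thus moves from the measure into the integrand. *)
Lemma normal_law_integral (Z : T -> R) v h (M : R) :
  measurable_fun setT Z -> 0 <= v ->
  (forall A, measurable A -> P (Z @^-1` A) = normal_law 0 v A) ->
  continuous h -> (forall x, `|h x| <= M) ->
  \int[P]_w h (Z w) = \int[normal_prob 0 1]_x h (Num.sqrt v * x).
Proof.
move=> mZ v0 lawZ ch hM.
have mh : measurable_fun setT h by exact: continuous_measurable_fun.
have mhZ : measurable_fun setT (h \o Z) by exact: measurableT_comp.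
have -> : \int[P]_w h (Z w) =
    fine (\int[pushforward P (Z : T -> measurableTypeR R)]_x (h x)%:E).
  rewrite integral_pushforward//; first exact/measurable_EFinP.
  by rewrite preimage_setT; exact: bounded_integrable (fun w => hM (Z w)).
have [v_eq0|v_neq0] := eqVneq v 0.
  rewrite v_eq0 sqrtr0; under eq_Rintegral do rewrite mul0r.
  rewrite Rintegral_prob_cst.
  rewrite (eq_measure_integral (dirac (0 : measurableTypeR R))); last first.
    by move=> A mA _; rewrite -[LHS]/(P (Z @^-1` A)) lawZ// /normal_law v_eq0 eqxx.
  by rewrite integral_dirac ?diracT ?mul1e//; exact/measurable_EFinP.
have s0 : 0 < Num.sqrt v by rewrite sqrtr_gt0 lt_neqAle eq_sym v_neq0.
rewrite -(normal_prob_scale s0 ch hM) /Rintegral; congr fine.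
apply: eq_measure_integral => A mA _.
by rewrite -[LHS]/(P (Z @^-1` A)) lawZ// /normal_law (negbTE v_neq0).
Qed.

End NormalIntegral.

(** * Convergence in distribution from projections *)

Lemma bounded_dominated_cvg (R : realType) (d : measure_display)
    (T : measurableType d) (P : probability T R) (f_ : nat -> T -> R) (f : T -> R)
    (M : R) :
  (forall n, measurable_fun setT (f_ n)) -> (forall n w, `|f_ n w| <= M) ->
  (forall w, f_ n w @[n --> \oo] --> f w) ->
  \int[P]_w f_ n w @[n --> \oo] --> \int[P]_w f w.
Proof.
move=> mf fM ff.
have mlim : measurable_fun setT f.
  by apply: (measurable_fun_cvg mf) => w _; exact: ff.
have flim w : `|f w| <= M.
  by apply: (cvgr_to_le (cvg_norm (ff w))); exact: nearW.
apply: fine_cvg; rewrite /Rintegral fineK; last first.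
  by apply: integrable_fin_num => //; exact: bounded_integrable flim.
apply: (@dominated_cvg _ _ _ P setT measurableT (fun n w => (f_ n w)%:E)
  (EFin \o f) (cst M%:E)) => //.
- by move=> n; exact/measurable_EFinP.
- by move=> w _; apply: cvg_EFin; [exact: nearW|exact: ff].
- by apply: (@bounded_integrable _ _ _ _ _ `|M|) => //.
- by move=> n w _; rewrite /= lee_fin.
Qed.

Section NormalLawConvergence.
Context (R : realType) (d : nat -> measure_display)
  (T : forall n, measurableType (d n)) (P : forall n, probability (T n) R)
  (d' : measure_display) (T' : measurableType d') (P' : probability T' R).

(** All expectations become integrals against the same standard normal law, so convergence of
    variances suffices by dominated convergence, even towards or through variance 0. *)
Lemma normal_law_cvg (Z : forall n, T n -> R) (Z' : T' -> R) (v_ : nat -> R) (v : R)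
    (h : R -> R) (M : R) :
  (forall n, measurable_fun setT (Z n)) -> measurable_fun setT Z' ->
  (forall n, 0 <= v_ n) -> 0 <= v ->
  (forall n A, measurable A -> P n (Z n @^-1` A) = normal_law 0 (v_ n) A) ->
  (forall A, measurable A -> P' (Z' @^-1` A) = normal_law 0 v A) ->
  v_ n @[n --> \oo] --> v -> continuous h -> (forall x, `|h x| <= M) ->
  \int[P n]_w h (Z n w) @[n --> \oo] --> \int[P']_w h (Z' w).
Proof.
move=> mZ mZ' v_0 v0 lZ lZ' vv ch hM.
rewrite (normal_law_integral mZ' v0 lZ' ch hM).
under eq_fun do rewrite (normal_law_integral (mZ _) (v_0 _) (lZ _) ch hM).
apply: (@bounded_dominated_cvg _ _ _ _ _ _ M).
- move=> n; apply: continuous_measurable_fun => x.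
  by apply: continuous_comp; [exact: mulrl_continuous|exact: ch].
- by move=> n w.
- move=> x; apply: (cvg_comp _ h); last exact: ch.
  apply: cvgM; last exact: cvg_cst.
  by apply: (cvg_comp _ _ vv); exact: sqrt_continuous.
Qed.

End NormalLawConvergence.

(** * From convergence of projections to convergence of continuous images *)

Section ProjectionConvergence.
Context (R : realType) (p : nat) (d : nat -> measure_display)
  (T : forall n, measurableType (d n)) (P : forall n, probability (T n) R)
  (d' : measure_display) (T' : measurableType d') (P' : probability T' R).
Variables (Z : forall n, T n -> 'cV[R]_p) (Z' : T' -> 'cV[R]_p).
Arguments Z : clear implicits.
Hypothesis mZ : forall n, random_vector (Z n).
Hypothesis mZ' : random_vector Z'.
Hypothesis Zcvg : forall (a : 'cV[R]_p) (h : R -> R) (M : R),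
  continuous h -> (forall x, `|h x| <= M) ->
  \int[P n]_w h (mx11_val (a^T *m Z n w)) @[n --> \oo] -->
  \int[P']_w h (mx11_val (a^T *m Z' w)).

Lemma trig_poly_bounded (f : 'cV[R]_p -> R) : trig_poly f ->
  exists M, forall x, `|f x| <= M.
Proof.
elim => {f} [c a b|f g _ [M fM] _ [N gN]].
  by exists `|c| => x; rewrite normrM ler_piMr// ler_norml cos_le1 cos_geN1.
by exists (M + N) => x; rewrite (le_trans (ler_normD _ _))// lerD.
Qed.

Lemma trig_poly_Rintegral_cvg (f : 'cV[R]_p -> R) : trig_poly f ->
  \int[P n]_w f (Z n w) @[n --> \oo] --> \int[P']_w f (Z' w).
Proof.
elim => {f} [c a b|f g tf cf tg cg].
  apply: (@Zcvg a (fun t => c * cos (t + b)) `|c|).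
    move=> t; apply: continuousM; first exact: cst_continuous.
    apply: continuous_comp; last exact: continuous_cos.
    by apply: continuousD; [exact: cvg_id|exact: cst_continuous].
  by move=> x; rewrite normrM ler_piMr// ler_norml cos_le1 cos_geN1.
have [M fM] := trig_poly_bounded tf; have [N gN] := trig_poly_bounded tg.
have E (d0 : measure_display) (T0 : measurableType d0) (P0 : probability T0 R)
    (Z0 : T0 -> 'cV[R]_p) : random_vector Z0 ->
    \int[P0]_w (f (Z0 w) + g (Z0 w)) =
    \int[P0]_w f (Z0 w) + \int[P0]_w g (Z0 w).
  move=> mZ0; rewrite RintegralD//.
    by apply: (@bounded_integrable _ _ _ _ _ M) => //; exact: (measurable_trig_poly mZ0 tf).
  by apply: (@bounded_integrable _ _ _ _ _ N) => //; exact: (measurable_trig_poly mZ0 tg).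
rewrite E//; under eq_fun do rewrite E//.
exact: cvgD.
Qed.

(** A continuous substitute for the indicator of a tail, rising from 0 at [|x| = K] to 1 at
    [|x| = K + 1]; the hypothesis [Zcvg] applies to it. *)
Definition tail_weight (K x : R) : R := Num.min 1 (Num.max 0 (`|x| - K)).

Lemma tail_weight_continuous K : continuous (tail_weight K).
Proof.
have c1 : continuous (cst 1 : R -> R) by exact: cst_continuous.
have c0 : continuous (cst 0 : R -> R) by exact: cst_continuous.
have cK : continuous (fun x : R => `|x| - K).
  by move=> x; apply: cvgB; [exact: norm_continuous|exact: cvg_cst].
move=> x; apply: (@continuous_min _ _ (cst 1) (cst 0 \max (fun x : R => `|x| - K)) x).
  exact: c1.
by apply: continuous_max; [exact: c0|exact: cK].
Qed.

Lemma tail_weight_ge0 K x : 0 <= tail_weight K x.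
Proof. by rewrite /tail_weight le_min ler01 le_max lexx. Qed.

Lemma tail_weight_le1 K x : tail_weight K x <= 1.
Proof. by rewrite /tail_weight ge_min lexx. Qed.

Lemma tail_weight_norm K x : `|tail_weight K x| <= 1.
Proof. by rewrite ger0_norm ?tail_weight_ge0// tail_weight_le1. Qed.

Lemma tail_weight_in K x : `|x| <= K -> tail_weight K x = 0.
Proof.
by move=> xK; rewrite /tail_weight max_l ?subr_le0// min_r// ler01.
Qed.

Lemma tail_weight_out K x : K + 1 < `|x| -> tail_weight K x = 1.
Proof.
move=> xK; rewrite /tail_weight min_l// le_max; apply/orP; right; lra.
Qed.

Lemma measurable_coord_tail_weight K i (d0 : measure_display)
    (T0 : measurableType d0) (Z0 : T0 -> 'cV[R]_p) : random_vector Z0 ->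
  measurable_fun setT (fun w => tail_weight K (Z0 w i ord0)).
Proof.
move=> mZ0; apply: (measurableT_comp (f := tail_weight K)); last exact: mZ0.
by apply: continuous_measurable_fun; exact: tail_weight_continuous.
Qed.

Lemma measurable_box L (d0 : measure_display)
    (T0 : measurableType d0) (Z0 : T0 -> 'cV[R]_p) : random_vector Z0 ->
  measurable [set w | ~ box L (Z0 w)].
Proof.
move=> mZ0; rewrite (_ : [set w | _] =
    ~` \bigcap_(i in [set: 'I_p]) [set w | `|Z0 w i ord0| <= L]).
  apply: measurableC; apply: fin_bigcap_measurable => // i _.
  rewrite -[X in measurable X]setTI.
  apply: (measurable_fun_le (f := fun w => `|Z0 w i ord0|) (g := cst L)) => //.
  by apply: measurableT_comp => //; exact: mZ0.
by apply/seteqP; split => w /= nb b; apply: nb => i; [exact: b|move=> _; exact: b].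
Qed.

(** Union bound over the coordinates: outside the box at least one weight equals 1. *)
Lemma out_box_le (K : R) (d0 : measure_display) (T0 : measurableType d0)
    (P0 : probability T0 R) (Z0 : T0 -> 'cV[R]_p) : random_vector Z0 ->
  fine (P0 [set w | ~ box (K + 1) (Z0 w)]) <=
  \sum_i \int[P0]_w tail_weight K (Z0 w i ord0).
Proof.
move=> mZ0.
have iT i : P0.-integrable setT (EFin \o (fun w => tail_weight K (Z0 w i ord0))).
  apply: (@bounded_integrable _ _ _ _ _ 1); first exact: measurable_coord_tail_weight.
  by move=> w; exact: tail_weight_norm.
have mB := measurable_box (K + 1) mZ0.
have -> : fine (P0 [set w | ~ box (K + 1) (Z0 w)]) =
    \int[P0]_w \1_[set w | ~ box (K + 1) (Z0 w)] w.
  by rewrite /Rintegral integral_indic// setIT.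
have -> : \sum_i \int[P0]_w tail_weight K (Z0 w i ord0) =
    \int[P0]_w (\sum_i tail_weight K (Z0 w i ord0)).
  rewrite /Rintegral; under [in RHS]eq_integral do rewrite -sumEFin.
  rewrite integral_sum// -EFin_sum_fine// => i _.
  exact: (integrable_fin_num measurableT (iT i)).
apply: le_Rintegral => //.
- apply: (@bounded_integrable _ _ _ _ _ 1) => // w.
  by rewrite ger0_norm// indicE lern1; case: (_ \in _).
- apply: (@bounded_integrable _ _ _ _ _ (\sum_(i < p) 1)).
    by apply: measurable_sum => i; exact: measurable_coord_tail_weight.
  move=> w; apply: le_trans (ler_norm_sum _ _ _) _.
  by apply: ler_sum => i _; exact: tail_weight_norm.
- move=> w _; rewrite indicE.
  have S0 (Q : pred 'I_p) : 0 <= \sum_(i | Q i) tail_weight K (Z0 w i ord0).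
    by apply: sumr_ge0 => i _; exact: tail_weight_ge0.
  case: (boolP (w \in _)) => [|_]; last exact: S0.
  rewrite inE /= => /existsNP[i /negP]; rewrite -ltNge => Ki.
  by rewrite (bigD1 i)//= tail_weight_out// lerDl S0.
Qed.

(** Dominated convergence gives a radius for the limit with a strict margin below [e]; convergence
    of the coordinate projections lets the same radius serve all large [n]. *)
Lemma tightness (e : R) : 0 < e -> exists2 L, 0 < L &
  fine (P' [set w | ~ box L (Z' w)]) <= e /\
  \forall n \near \oo, fine (P n [set w | ~ box L (Z n w)]) <= e.
Proof.
move=> e0.
have lim0 i : \int[P']_w tail_weight k%:R (Z' w i ord0) @[k --> \oo] --> (0 : R).
  rewrite -(Rintegral_prob_cst P' 0).
  apply: (@bounded_dominated_cvg _ _ _ _ _ _ 1).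
  - by move=> k; exact: measurable_coord_tail_weight.
  - by move=> k w; exact: tail_weight_norm.
  - move=> w; apply: cvg_near_cst; near=> k; apply: tail_weight_in.
    by near: k; exact: nbhs_infty_ger.
have sum0 : \sum_i \int[P']_w tail_weight k%:R (Z' w i ord0) @[k --> \oo] --> (0 : R).
  rewrite [X in _ --> X](_ : 0 = \sum_(i < p) 0); last by rewrite big1.
  by apply: cvgr_sum => i; exact: lim0.
have /cvgrPdist_lt/(_ _ e0)[k _ /(_ k (leqnn _))] := sum0.
rewrite sub0r normrN => ke.
exists (k%:R + 1); first by rewrite ltr_wpDl.
split.
  rewrite (le_trans (out_box_le k%:R P' mZ'))//.
  by rewrite (le_trans (ler_norm _))// ltW.
have cvgk : \sum_i \int[P n]_w tail_weight k%:R (Z n w i ord0) @[n --> \oo] -->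
    \sum_i \int[P']_w tail_weight k%:R (Z' w i ord0).
  apply: cvgr_sum => i.
  have := @Zcvg (delta_mx i ord0) (tail_weight k%:R) 1.
  have E x : mx11_val ((delta_mx i ord0)^T *m x) = x i ord0 :> R.
    by rewrite trmx_delta -rowE /mx11_val mxE.
  under eq_fun do (under eq_Rintegral do rewrite E).
  under [X in _ -> _ -> _ --> X]eq_Rintegral do rewrite E.
  by apply; [exact: tail_weight_continuous|exact: tail_weight_norm].
have e1 : 0 < e - \sum_i \int[P']_w tail_weight k%:R (Z' w i ord0).
  by rewrite subr_gt0 (le_lt_trans (ler_norm _)).
move/cvgrPdist_lt : cvgk => /(_ _ e1) near1.
near=> n; rewrite (le_trans (out_box_le k%:R (P n) (Z0 := Z n) (@mZ n)))//.
have : `|\sum_i \int[P']_w tail_weight k%:R (Z' w i ord0) -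
   \sum_i \int[P n]_w tail_weight k%:R (Z n w i ord0)| <
   e - \sum_i \int[P']_w tail_weight k%:R (Z' w i ord0).
  by near: n.
rewrite distrC => /(le_lt_trans (ler_norm _)); lra.
Unshelve. all: by end_near. Qed.

(** Continuous mapping and Slutsky combined, through the chain [f (Y n)], [f (A (Z n))], [t (Z n)],
    [t (Z')], [f (A (Z'))] with [t] a trigonometric polynomial. [K] is chosen before [e], so that
    [e] can be a modulus of continuity of [f] on the box of radius [K]. *)
Lemma Rintegral_cvg_asymptotic_image (A : 'cV[R]_p -> 'cV[R]_p)
    (Y : forall n, T n -> 'cV[R]_p) (f : 'cV[R]_p -> R) (M : R) :
  (forall n, random_vector (Y n)) ->
  continuous A -> continuous f -> (forall x, `|f x| <= M) ->
  (forall L, exists K, forall e, 0 < e -> \forall n \near \oo,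
    forall w, box L (Z n w) -> [/\ box K (Y n w), box K (A (Z n w)) &
      forall i, `|Y n w i ord0 - A (Z n w) i ord0| < e]) ->
  \int[P n]_w f (Y n w) @[n --> \oo] --> \int[P']_w f (A (Z' w)).
Proof.
move=> mY cA cf fM YA.
have M0 : 0 <= M by exact: le_trans (normr_ge0 _) (fM 0).
apply/cvgrPdist_le => e e0.
(* The three errors below are [r + 2 * M * r], [r] and [2 * r + 2 * M * r], which add up to [e]. *)
pose r := e / (4 + 4 * M).
have r0 : 0 < r by rewrite divr_gt0//; lra.
have [L L0 [PL' PL]] := tightness r0.
have [K YK] := YA L.
have [dl dl0 fdl] := continuous_box_unif K cf r0.
have cfA : continuous (f \o A).
  by move=> x; apply: continuous_comp; [exact: cA|exact: cf].
have [|t [tt tM tfA]] := @trig_poly_approx _ _ (f \o A) M L r cfA L0 r0.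
  by move=> x _; exact: fM.
have mt := measurable_trig_poly mZ' tt.
have h1 : `|\int[P']_w f (A (Z' w)) - \int[P']_w t (Z' w)| <= r + 2 * M * r.
  apply: le_trans (@Rintegral_dist_le _ _ _ _ (f \o A \o Z') (t \o Z') _ M r
    _ _ (measurable_box L mZ') _ _ _ _) _ => //.
  - exact: measurable_continuous_comp.
  - by move=> w; exact: fM.
  - by move=> w; exact: tM.
  - exact: ltW.
  - by move=> w /= /contrapT bL; rewrite distrC; exact: tfA.
  - by rewrite lerD2l ler_wpM2l// mulr_ge0.
have /cvgrPdist_lt/(_ _ r0) h2 := trig_poly_Rintegral_cvg tt.
near=> n.
have h3 : `|\int[P']_w t (Z' w) - \int[P n]_w t (Z n w)| < r by near: n.
have Pn : fine (P n [set w | ~ box L (Z n w)]) <= r by near: n.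
have Yn : forall w, box L (Z n w) -> [/\ box K (Y n w), box K (A (Z n w)) &
      forall i, `|Y n w i ord0 - A (Z n w) i ord0| < dl].
  by near: n; exact: YK.
have h4 : `|\int[P n]_w t (Z n w) - \int[P n]_w f (Y n w)| <= 2 * r + 2 * M * r.
  apply: le_trans (@Rintegral_dist_le _ _ _ _ (t \o Z n) (f \o Y n) _ M (2 * r)
    _ _ (measurable_box L (@mZ n)) _ _ _ _) _ => //.
  - exact: measurable_trig_poly.
  - exact: measurable_continuous_comp.
  - by move=> w; exact: tM.
  - by move=> w; exact: fM.
  - by rewrite mulr_ge0// ltW.
  - move=> w /= /contrapT bL; have [YK1 AK YAd] := Yn _ bL.
    rewrite (le_trans (ler_distD (f (A (Z n w))) _ _))// mulr_natl mulr2n lerD//.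
      exact: tfA.
    by rewrite distrC; exact: fdl.
  - by rewrite lerD2l ler_wpM2l// mulr_ge0.
have rE : (4 + 4 * M) * r = e by rewrite /r; field; lra.
have := ler_distD (\int[P']_w t (Z' w)) (\int[P']_w f (A (Z' w))) (\int[P n]_w f (Y n w)).
have := ler_distD (\int[P n]_w t (Z n w)) (\int[P']_w t (Z' w)) (\int[P n]_w f (Y n w)).
nra.
Unshelve. all: by end_near. Qed.

End ProjectionConvergence.

(** * The smoothed absolute value *)

Section NormalPenalty.
Context (R : realType).
Local Notation mu := (@lebesgue_measure R).
Local Notation tau := ((Num.sqrt 2)^-1 : R).

Let tau_gt0 : 0 < tau. Proof. by rewrite invr_gt0 sqrtr_gt0. Qed.

(** As [tau ^+ 2 = 1 / 2], the left density is proportional to [exp (- x ^ 2)]. Half of the exponent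
    absorbs [|x|], because [|x| <= 1 + x ^ 2 / 2 <= exp (x ^ 2 / 2)]. *)
Lemma norm_normal_pdf_le (x : R) :
  `|x| * normal_pdf 0 tau x <= normal_peak tau / normal_peak 1 * normal_pdf 0 1 x.
Proof.
rewrite !normal_pdfE ?gt_eqF//= /normal_fun !subr0.
rewrite mulrCA -[leRHS]mulrA ler_wpM2l ?normal_peak_ge0//.
rewrite mulKf ?gt_eqF ?normal_peak_gt0//.
have -> : - x ^+ 2 / (tau ^+ 2 *+ 2) = - x ^+ 2 / 2 + - (x ^+ 2 / 2).
  rewrite exprVn sqr_sqrtr// -mulr_natr mulVf//.
  by field.
have -> : - x ^+ 2 / (1 ^+ 2 *+ 2) = - x ^+ 2 / 2 by rewrite expr1n.
rewrite expRD mulrCA -[leRHS]mulr1 ler_wpM2l ?expR_ge0//.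
rewrite expRN ler_pdivrMr ?expR_gt0// mul1r.
apply: le_trans (expR_ge1Dx _).
rewrite -[x ^+ 2]real_normK ?num_real//.
have := sqr_ge0 (`|x| - 1); rewrite sqrrB1; lra.
Qed.

(* Markov's inequality, [|x|] times the density being dominated by a multiple
   of the standard normal density *)
Lemma normal_prob_tail (z : R) (A : set R) : measurable A ->
  (forall x, A x -> `|z| <= `|x|) ->
  `|z| * fine (normal_prob 0 tau A) <= normal_peak tau / normal_peak 1.
Proof.
move=> mA zA.
have mpdf s : measurable_fun A (fun x => (normal_pdf 0 s x)%:E).
  by apply/measurable_funTS/measurableT_comp => //; exact: measurable_normal_pdf.
have C0 : 0 <= normal_peak tau / normal_peak 1 by rewrite divr_ge0 ?normal_peak_ge0.
rewrite -lee_fin EFinM fineK ?fin_num_measure//.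
rewrite /normal_prob -ge0_integralZl//=; last 2 first.
- exact: mpdf.
- by move=> x _; rewrite lee_fin normal_pdf_ge0.
apply: (@le_trans _ _ (\int[mu]_(x in A)
    ((normal_peak tau / normal_peak 1)%:E * (normal_pdf 0 1 x)%:E))%E).
  apply: ge0_le_integral => //=.
  - by move=> x _; rewrite -EFinM lee_fin mulr_ge0// normal_pdf_ge0.
  - by apply: emeasurable_funM; [exact: measurable_cst|exact: mpdf].
  - by apply: emeasurable_funM; [exact: measurable_cst|exact: mpdf].
  - move=> x Ax; rewrite -!EFinM lee_fin.
    apply: le_trans (norm_normal_pdf_le x).
    by rewrite ler_wpM2r ?normal_pdf_ge0// zA.
rewrite ge0_integralZl//=; last 2 first.
- exact: mpdf.
- by move=> x _; rewrite lee_fin normal_pdf_ge0.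
rewrite -[X in (_ <= X)%E]mule1 lee_wpmul2l ?lee_fin//.
exact: (probability_le1 (normal_prob 0 1)).
Qed.

(** By homogeneity put [b = s * z]. The error is then [2 * s * |z|] times the mass of the tail
    beyond [z] on its own side of 0, which [normal_prob_tail] bounds. *)
Lemma smoothed_abs_error (b s : R) : 0 < s ->
  `|b * (2 * normal_cdf (b / s) 0 tau - 1) - `|b| | <=
  2 * (normal_peak tau / normal_peak 1) * s.
Proof.
move=> s0; set C := normal_peak tau / normal_peak 1.
pose z := b / s; have -> : b = s * z by rewrite /z mulrCA divff ?mulr1// gt_eqF.
have -> : s * z / s = z by rewrite mulrAC divff ?mul1r// gt_eqF.
rewrite normrM gtr0_norm// -mulrA -mulrBr normrM gtr0_norm// mulrC ler_wpM2r ?(ltW s0)//.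
clearbody z; have [z0|z0] := leP 0 z.
  have zi : normal_cdf z 0 tau = 1 - fine (normal_prob 0 tau `]z, +oo[).
    rewrite /normal_cdf -[`]-oo, z]%classic]setCK setCitvl.
    rewrite probability_setC// fineB// fin_num_measure//.
  have := @normal_prob_tail z `]z, +oo[ (measurable_itv _).
  rewrite -/C !(ger0_norm z0) zi => H.
  have /H {}H : forall x, `]z, +oo[%classic x -> z <= `|x|.
    move=> x /=; rewrite in_itv/= andbT => zx.
    by rewrite (le_trans (ltW zx))// ler_norm.
  have F0 : 0 <= fine (normal_prob 0 tau `]z, +oo[) by rewrite fine_ge0.
  rewrite (_ : _ - z = - (2 * (z * fine (normal_prob 0 tau `]z, +oo[)))); last by ring.
  by rewrite normrN ger0_norm ?ler_pM2l// !mulr_ge0.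
have := @normal_prob_tail z `]-oo, z] (measurable_itv _).
rewrite -/C -/(normal_cdf z 0 tau) !(ltr0_norm z0) => H.
have /H {}H : forall x, `]-oo, z]%classic x -> - z <= `|x|.
  move=> x /=; rewrite in_itv/= => zx.
  by rewrite ler0_norm ?lerN2// (le_trans zx)// ltW.
have F0 : 0 <= normal_cdf z 0 tau by rewrite fine_ge0.
rewrite (_ : _ - - z = - (2 * (- z * normal_cdf z 0 tau))); last by ring.
by rewrite normrN ger0_norm ?ler_pM2l// !mulr_ge0// oppr_ge0 ltW.
Qed.

End NormalPenalty.

(** * Quadratic forms and the limit objective *)

Section ScalarMatrix.
Context (R : realType).
Implicit Types (A B : 'M[R]_1) (a : R).

Lemma mx11_valD A B : mx11_val (A + B) = mx11_val A + mx11_val B.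
Proof. by rewrite /mx11_val mxE. Qed.

Lemma mx11_valN A : mx11_val (- A) = - mx11_val A.
Proof. by rewrite /mx11_val mxE. Qed.

Lemma mx11_valB A B : mx11_val (A - B) = mx11_val A - mx11_val B.
Proof. by rewrite mx11_valD mx11_valN. Qed.

Lemma mx11_valZ a A : mx11_val (a *: A) = a * mx11_val A.
Proof. by rewrite /mx11_val mxE. Qed.

End ScalarMatrix.

Section QuadraticForm.
Context (R : realType) (p : nat).
Implicit Types (u v w : 'cV[R]_p) (M : 'M[R]_p).

Definition sqnorm u : R := \sum_i u i ord0 ^+ 2.

Definition quad M u : R := mx11_val (u^T *m M *m u).

(** A crude norm that controls quadratic forms and tends to 0 with the entries. *)
Definition entry_sum M : R := \sum_i \sum_j `|M i j|.

Lemma mx11_val_dotE u v : mx11_val (u^T *m v) = \sum_i u i ord0 * v i ord0.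
Proof. by rewrite /mx11_val mxE; apply: eq_bigr => i _; rewrite mxE. Qed.

Lemma mx11_val_sqnorm u : mx11_val (u^T *m u) = sqnorm u.
Proof. by rewrite mx11_val_dotE; apply: eq_bigr => i _; rewrite expr2. Qed.

Lemma quadE M u : quad M u = \sum_i \sum_j u i ord0 * M i j * u j ord0.
Proof.
rewrite /quad -mulmxA mx11_val_dotE; apply: eq_bigr => i _.
by rewrite mxE mulr_sumr; apply: eq_bigr => j _; rewrite mulrA.
Qed.

Lemma quadB M N u : quad (M - N) u = quad M u - quad N u.
Proof. by rewrite /quad mulmxBr mulmxBl mx11_valB. Qed.

Lemma quadZ (a : R) M u : quad (a *: M) u = a * quad M u.
Proof. by rewrite /quad -scalemxAr -scalemxAl mx11_valZ. Qed.

Lemma sqnorm_ge0 u : 0 <= sqnorm u.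
Proof. by apply: sumr_ge0 => i _; exact: sqr_ge0. Qed.

Lemma sqr_coord_le u i : u i ord0 ^+ 2 <= sqnorm u.
Proof. by rewrite /sqnorm (bigD1 i)//= lerDl sumr_ge0// => j _; exact: sqr_ge0. Qed.

Lemma sqnorm_eq0 u : sqnorm u <= 0 -> u = 0.
Proof.
move=> u0; apply/colP => i; rewrite mxE; apply/eqP.
by rewrite -(sqrf_eq0) eq_le sqr_ge0 (le_trans (sqr_coord_le u i)).
Qed.

Lemma sqnormN u : sqnorm (- u) = sqnorm u.
Proof. by apply: eq_bigr => i _; rewrite mxE sqrrN. Qed.

Lemma sqnormD_le u v : sqnorm (u + v) <= 2 * (sqnorm u + sqnorm v).
Proof.
rewrite /sqnorm -big_split/= mulr_sumr; apply: ler_sum => i _; rewrite mxE.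
have := sqr_ge0 (u i ord0 - v i ord0).
lra.
Qed.

Lemma entry_sum_ge0 M : 0 <= entry_sum M.
Proof. by apply: sumr_ge0 => i _; apply: sumr_ge0 => j _. Qed.

Lemma norm_quad_le M u : `|quad M u| <= entry_sum M * sqnorm u.
Proof.
rewrite quadE mulr_suml; apply: le_trans (ler_norm_sum _ _ _) _.
apply: ler_sum => i _; rewrite mulr_suml; apply: le_trans (ler_norm_sum _ _ _) _.
apply: ler_sum => j _; rewrite mulrAC normrM mulrC ler_wpM2l//.
have h1 := sqr_coord_le u i; have h2 := sqr_coord_le u j.
rewrite normrM.
have := sqr_ge0 (`|u i ord0| - `|u j ord0|).
rewrite sqrrB !real_normK ?num_real// mulr2n. lra.
Qed.

(** The last term is the gain at midpoints that makes the limit objective strongly convex. *)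
Lemma quad_parallelogram M u v :
  quad M (2^-1 *: (u + v)) = (quad M u + quad M v) / 2 - quad M (u - v) / 4.
Proof.
rewrite /quad [(2^-1 *: (u + v))^T]linearZ/= -!scalemxAl -scalemxAr.
rewrite [(u + v)^T]linearD [(u - v)^T]linearB/=.
rewrite !(mulmxDl, mulmxDr, mulmxN, mulNmx, mx11_valZ, mx11_valN, mx11_valD).
by field.
Qed.

(* Positivity at [u - t *: M^-1 *m u] for a small [t] bounds the form from below. *)
Lemma psd_unitmx_pd M : M^T = M -> (forall u, 0 <= quad M u) -> M \in unitmx ->
  exists2 c, 0 < c & forall u, c * sqnorm u <= quad M u.
Proof.
move=> sM pM uM; pose K := entry_sum (invmx M) + 1.
have K0 : 0 < K by rewrite ltr_wpDl ?entry_sum_ge0.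
exists K^-1; first by rewrite invr_gt0.
move=> u; pose t : R := K^-1; pose y := invmx M *m u.
have MY : M *m y = u by rewrite /y mulmxA mulmxV// mul1mx.
have YM : y^T *m M = u^T by rewrite -[in LHS]sM -trmx_mul MY.
have := pM (u - t *: y).
have -> : quad M (u - t *: y) = quad M u - 2 * t * sqnorm u + t ^+ 2 * quad (invmx M) u.
  have yE : mx11_val (u^T *m y) = quad (invmx M) u by rewrite /quad /y mulmxA.
  rewrite /quad [(u - t *: y)^T]linearB/= [(t *: y)^T]linearZ/=.
  rewrite mulmxBl -scalemxAl YM mulmxBl -scalemxAl !mulmxBr -!scalemxAr.
  rewrite -[u^T *m M *m y]mulmxA MY !(mx11_valZ, mx11_valB) yE mx11_val_sqnorm.
  by rewrite -/(quad M u) -/(quad (invmx M) u); ring.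
have := norm_quad_le (invmx M) u; rewrite ler_norml => /andP[_ h1] h2.
have h3 : t ^+ 2 * quad (invmx M) u <= t * sqnorm u.
  rewrite expr2 -mulrA ler_pM2l ?invr_gt0// ler_pdivrMl//.
  by rewrite (le_trans h1)// ler_wpM2r ?sqnorm_ge0// lerDl.
by rewrite -/t; lra.
Qed.

End QuadraticForm.

(** * Strong convexity of the limit objective and its argmin map *)

Section LimitObjective.
Context (R : realType) (p : nat).
Variables (beta : 'cV[R]_p) (Sigma : 'M[R]_p) (lambda0 c : R).
Hypothesis lambda0_ge0 : 0 <= lambda0.
Hypothesis c_gt0 : 0 < c.
Hypothesis Sigma_pd : forall u, c * sqnorm u <= quad Sigma u.
Implicit Types (u v w : 'cV[R]_p) (b x : R).

(* the directional derivative of the absolute value at [b] *)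
Definition dabs b x : R :=
  x * Num.sg b * (b != 0)%:R + `|x| * (b == 0)%:R.

Lemma dabs0 b : dabs b 0 = 0.
Proof. by rewrite /dabs normr0 !mul0r addr0. Qed.

Lemma dabs_lipschitz b x x' : `|dabs b x - dabs b x'| <= `|x - x'|.
Proof.
rewrite /dabs; have [b0|b0] /= := eqVneq b 0.
  by rewrite !mulr0 !add0r !mulr1 ler_dist_dist.
rewrite !mulr0 !addr0 !mulr1 -mulrBl normrM ler_piMr//.
by rewrite normr_sg; case: (_ != _).
Qed.

Lemma dabs_midpoint b x x' :
  dabs b (2^-1 * (x + x')) <= (dabs b x + dabs b x') / 2.
Proof.
rewrite /dabs; have [b0|b0] /= := eqVneq b 0.
  rewrite !mulr0 !add0r !mulr1 normrM gtr0_norm ?invr_gt0// mulrC.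
  by rewrite ler_pM2r ?invr_gt0// ler_normD.
by rewrite !mulr0 !addr0 !mulr1; lra.
Qed.

Local Notation k := (limit_objective beta Sigma lambda0).

Lemma limit_objectiveE w u : k w u =
  - 2 * (\sum_i u i ord0 * w i ord0) + quad Sigma u +
  lambda0 * \sum_i dabs (beta i ord0) (u i ord0).
Proof. by rewrite /limit_objective mx11_val_dotE. Qed.

Lemma limit_objective0 w : k w 0 = 0.
Proof.
rewrite limit_objectiveE /quad mulmx0 /mx11_val mxE addr0.
rewrite big1 ?mulr0 ?add0r; last by move=> i _; rewrite mxE mul0r.
by rewrite big1 ?mulr0// => i _; rewrite mxE dabs0.
Qed.

Lemma limit_objective_continuous w : continuous (k w).
Proof.
have -> : k w = fun u => - 2 * (\sum_i u i ord0 * w i ord0) +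
    (\sum_i \sum_j u i ord0 * Sigma i j * u j ord0) +
    lambda0 * \sum_i dabs (beta i ord0) (u i ord0).
  by apply/funext => u; rewrite limit_objectiveE quadE.
suff lim (F : set_system 'cV[R]_p) (FF : Filter F) (u : 'cV[R]_p) :
    (forall i, u' i ord0 @[u' --> F] --> u i ord0) ->
    - 2 * (\sum_i u' i ord0 * w i ord0) +
      (\sum_i \sum_j u' i ord0 * Sigma i j * u' j ord0) +
      lambda0 * \sum_i dabs (beta i ord0) (u' i ord0) @[u' --> F] -->
    - 2 * (\sum_i u i ord0 * w i ord0) +
      (\sum_i \sum_j u i ord0 * Sigma i j * u j ord0) +
      lambda0 * \sum_i dabs (beta i ord0) (u i ord0).
  by move=> u; apply: (lim (nbhs u) _ u) => i; exact: coord_continuous.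
move=> cc; apply: cvgD; first apply: cvgD.
- apply: cvgM; first exact: cvg_cst.
  by apply: cvgr_sum => i; apply: cvgM; [exact: cc|exact: cvg_cst].
- apply: cvgr_sum => i; apply: cvgr_sum => j; apply: cvgM; last exact: cc.
  by apply: cvgM; [exact: cc|exact: cvg_cst].
- apply: cvgM; first exact: cvg_cst.
  apply: cvgr_sum => i; apply/cvgrPdist_lt => e e0.
  have /cvgrPdist_lt/(_ _ e0) := cc i.
  by apply: filterS => u'; exact/le_lt_trans/dabs_lipschitz.
Qed.

(** Coordinatewise completion of the square: with [a = 2 * |z| + lambda0], the linear and penalty
    terms are at least [- a * |x|], and [a * |x| <= c / 2 * x ^ 2 + a ^ 2 / (2 * c)]. *)
Lemma limit_objective_coercive w u :
  c / 2 * sqnorm u - \sum_i (2 * `|w i ord0| + lambda0) ^+ 2 / (2 * c) <= k w u.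
Proof.
rewrite limit_objectiveE.
have h1 : c / 2 * sqnorm u - \sum_i (2 * `|w i ord0| + lambda0) ^+ 2 / (2 * c) <=
   c * sqnorm u - 2 * (\sum_i u i ord0 * w i ord0) +
   lambda0 * \sum_i dabs (beta i ord0) (u i ord0).
  rewrite /sqnorm !mulr_sumr -!sumrB -big_split/=; apply: ler_sum => i _.
  set a := 2 * _ + lambda0; set x := u i ord0; set z := w i ord0 in a *.
  have hd : - `|x| <= dabs (beta i ord0) x.
    have := dabs_lipschitz (beta i ord0) x 0.
    by rewrite dabs0 !subr0 ler_norml => /andP[].
  have hd' := ler_wpM2l lambda0_ge0 hd.
  have hz : x * z <= `|x| * `|z| by rewrite -normrM ler_norm.
  have key : 0 <= (c * `|x| - a) ^+ 2 / (2 * c).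
    by rewrite divr_ge0 ?sqr_ge0// mulr_ge0// ltW.
  have E : (c * `|x| - a) ^+ 2 / (2 * c) =
    c / 2 * x ^+ 2 - a * `|x| + a ^+ 2 / (2 * c).
    by rewrite -[x ^+ 2]real_normK ?num_real//; field; rewrite gt_eqF.
  by move: key; rewrite E {E} /a mulrDl; lra.
by have := Sigma_pd u; lra.
Qed.

Lemma limit_objective_has_min w : exists u, is_minimizer (k w) u.
Proof.
pose S := \sum_i (2 * `|w i ord0| + lambda0) ^+ 2 / (2 * c).
have S0 : 0 <= S.
  by apply: sumr_ge0 => i _; rewrite divr_ge0 ?sqr_ge0// mulr_ge0// ltW.
(* Outside this box [c / 2 * sqnorm v >= c / 2 * M >= S], using [1 <= M], so the objective is
   nonnegative there, whereas it vanishes at 0. *)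
pose M := 1 + 2 * S / c.
have M0 : 0 <= M by rewrite addr_ge0// divr_ge0 ?mulr_ge0// ltW.
have [u ku] := continuous_box_min M0 (@limit_objective_continuous w).
exists u => v; have [|] := pselect (box M v); first exact: ku.
move=> /existsNP[i /negP]; rewrite -ltNge => Mv.
have ku0 : k w u <= 0.
  by rewrite -(limit_objective0 w); apply: ku => j; rewrite mxE normr0.
apply: le_trans ku0 _; apply: le_trans (limit_objective_coercive w v).
rewrite -/S subr_ge0.
have MS : S <= c / 2 * M.
  have E : c / 2 * M = c / 2 + S by rewrite /M; field; rewrite gt_eqF.
  by rewrite E lerDr divr_ge0 // ltW.
have M1 : 1 <= M by rewrite lerDl divr_ge0 ?mulr_ge0// ltW.
apply: le_trans MS _; rewrite ler_pM2l ?divr_gt0//.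
apply: le_trans (sqr_coord_le v i); rewrite -real_normK ?num_real//.
by clearbody M; nra.
Qed.

(** Minimality of [u] is tested at the midpoint of [u] and [v], where strong convexity puts the
    objective at least [c / 4 * sqnorm (v - u)] below the average of the two values. *)
Lemma limit_objective_growth w u v : is_minimizer (k w) u ->
  c / 2 * sqnorm (v - u) <= k w v - k w u.
Proof.
move=> mu; have := mu (2^-1 *: (v + u)).
have -> : k w (2^-1 *: (v + u)) = - (\sum_i (v i ord0 + u i ord0) * w i ord0) +
    quad Sigma (2^-1 *: (v + u)) +
    lambda0 * \sum_i dabs (beta i ord0) (2^-1 * (v i ord0 + u i ord0)).
  rewrite limit_objectiveE.
  under [X in _ + lambda0 * X]eq_bigr do rewrite !mxE.
  congr (_ + _ + _); rewrite mulr_sumr -sumrN; apply: eq_bigr => i _.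
  by rewrite !mxE; field.
have hm : lambda0 * \sum_i dabs (beta i ord0) (2^-1 * (v i ord0 + u i ord0)) <=
   lambda0 * ((\sum_i dabs (beta i ord0) (v i ord0) +
               \sum_i dabs (beta i ord0) (u i ord0)) / 2).
  rewrite ler_wpM2l// -big_split/= mulr_suml; apply: ler_sum => i _.
  exact: dabs_midpoint.
rewrite quad_parallelogram !limit_objectiveE.
have -> : \sum_i (v i ord0 + u i ord0) * w i ord0 =
    \sum_i v i ord0 * w i ord0 + \sum_i u i ord0 * w i ord0.
  by rewrite -big_split/=; apply: eq_bigr => i _; rewrite mulrDl.
by have := Sigma_pd (v - u); lra.
Qed.

Lemma limit_objective_unique w : exists! u, is_minimizer (k w) u.
Proof.
have [u mu] := limit_objective_has_min w; exists u; split => // v mv.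
have := limit_objective_growth v mu; have := mv u.
move=> h1 h2; apply/esym/eqP; rewrite -subr_eq0; apply/eqP/sqnorm_eq0.
rewrite -(@pmulr_rle0 _ (c / 2)) ?divr_gt0//; lra.
Qed.

Lemma argmin_limit_objective w : is_minimizer (k w) (argmin (k w)).
Proof.
exact: (@xgetPex _ 0 [set x | is_minimizer (k w) x] (limit_objective_has_min w)).
Qed.

(** Quadratic growth is added up at the two minimizers. Only the linear term depends on [w], so the
    sum is [2 <u - u', w - w'>], and Young's inequality absorbs half of the left side. *)
Lemma argmin_lipschitz w w' :
  sqnorm (argmin (k w) - argmin (k w')) <= 4 / c ^+ 2 * sqnorm (w - w').
Proof.
set u := argmin (k w); set u' := argmin (k w').
have h1 := limit_objective_growth u' (argmin_limit_objective w).
have h2 := limit_objective_growth u (argmin_limit_objective w').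
have e1 : k w u' - k w u + (k w' u - k w' u') =
    2 * \sum_i (u - u') i ord0 * (w - w') i ord0.
  rewrite !limit_objectiveE.
  have -> : \sum_i (u - u') i ord0 * (w - w') i ord0 =
     \sum_i u i ord0 * w i ord0 - \sum_i u i ord0 * w' i ord0 -
     \sum_i u' i ord0 * w i ord0 + \sum_i u' i ord0 * w' i ord0.
    rewrite -!sumrB -big_split/=; apply: eq_bigr => i _; rewrite !mxE; ring.
  by ring.
have young : 2 * \sum_i (u - u') i ord0 * (w - w') i ord0 <=
    c / 2 * sqnorm (u - u') + 2 / c * sqnorm (w - w').
  rewrite /sqnorm !mulr_sumr -big_split/=; apply: ler_sum => i _.
  set x := (u - u') i ord0; set z := (w - w') i ord0.
  have key : 0 <= (c * x - 2 * z) ^+ 2 / (2 * c).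
    by rewrite divr_ge0 ?sqr_ge0// mulr_ge0// ltW.
  have E : (c * x - 2 * z) ^+ 2 / (2 * c) = c / 2 * x ^+ 2 - 2 * (x * z) + 2 / c * z ^+ 2.
    by field; rewrite gt_eqF.
  by move: key; rewrite E; lra.
rewrite -sqnormN opprB -/u -/u' in h1.
have h3 : c / 2 * sqnorm (u - u') <= 2 / c * sqnorm (w - w') by lra.
rewrite -ler_pdivlMl ?divr_gt0// in h3; apply: le_trans h3 _.
by rewrite mulrA le_eqVlt; apply/orP; left; apply/eqP; congr (_ * _); field; rewrite gt_eqF.
Qed.

Lemma argmin_continuous : continuous (fun w => argmin (k w)).
Proof.
move=> w B /nbhs_ballP[e /= e0 eB].
(* Balls are entrywise, so passing to [sqnorm] costs a factor [p]. Using [p.+1] covers [p = 0] and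
   leaves the ratio [p / p.+1 ^ 2], strictly below 1. *)
pose d := e * c / (2 * p.+1%:R).
have d0 : 0 < d by rewrite divr_gt0// mulr_gt0.
apply/nbhs_ballP; exists d => //= w' [_ ww']; apply: eB.
split => // i j; rewrite ord1 -ball_normE/=.
have h1 : sqnorm (w - w') <= p%:R * d ^+ 2.
  rewrite mulr_natl -[p in X in _ <= X]card_ord -sumr_const.
  apply: ler_sum => l _; have := ww' l ord0; rewrite -ball_normE/= => wl.
  rewrite !mxE -[leLHS]real_normK ?num_real//.
  by rewrite ler_sqr ?nnegrE// ltW.
have := sqr_coord_le (argmin (k w) - argmin (k w')) i.
move=> /le_trans/(_ (argmin_lipschitz w w')); rewrite !mxE => h2.
have h3 : (argmin (k w) i ord0 - argmin (k w') i ord0) ^+ 2 < e ^+ 2.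
  apply: (le_lt_trans h2); apply: le_lt_trans (ler_wpM2l _ h1) _.
    by rewrite divr_ge0// exprn_ge0// ltW.
  have -> : 4 / c ^+ 2 * (p%:R * d ^+ 2) = e ^+ 2 * (p%:R / p.+1%:R ^+ 2).
    have q0 : p.+1%:R != 0 :> R by rewrite pnatr_eq0.
    by rewrite /d; move: (p.+1%:R) q0 => q q0; field; rewrite q0 gt_eqF.
  rewrite gtr_pMr ?exprn_gt0// ltr_pdivrMr ?exprn_gt0// mul1r -natrX ltr_nat.
  by rewrite expnS expn1 mulSn addSn ltnS leq_addr.
by rewrite -[ltLHS]normr_id -[ltRHS]gtr0_norm// -ltr_sqr ?nnegrE// !real_normK ?num_real.
Qed.

End LimitObjective.

(** * The rescaled penalized objective *)

Section RssExpansion.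
Context (R : realType) (n p : nat).
Implicit Types (X : 'M[R]_(n, p)) (e : 'cV[R]_n) (u v : 'cV[R]_p).

Lemma rss_expansion X e v :
  mx11_val ((e - X *m v)^T *m (e - X *m v)) =
  mx11_val (e^T *m e) - 2 * mx11_val (v^T *m (X^T *m e)) + quad (X^T *m X) v.
Proof.
have -> : mx11_val (v^T *m (X^T *m e)) = mx11_val (e^T *m (X *m v)).
  by rewrite mulmxA -trmx_mul !mx11_val_dotE; apply: eq_bigr => i _; rewrite mulrC.
have -> : quad (X^T *m X) v = mx11_val ((X *m v)^T *m (X *m v)).
  by rewrite /quad trmx_mul !mulmxA.
rewrite [(e - X *m v)^T]linearB/=.
rewrite !(mulmxDl, mulmxDr, mulmxN, mulNmx, mx11_valN, mx11_valD).
have -> : mx11_val ((X *m v)^T *m e) = mx11_val (e^T *m (X *m v)).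
  by rewrite !mx11_val_dotE; apply: eq_bigr => i _; rewrite mulrC.
by ring.
Qed.

(** For [r > 0] this is [r (|b + x / r| - |b|)], the increment of the absolute value in rescaled
    coordinates. *)
Definition shifted_abs (r b x : R) : R := `|r * b + x| - `|r * b|.

Lemma shifted_abs_le (r b x : R) : `|shifted_abs r b x| <= `|x|.
Proof.
rewrite /shifted_abs; apply: le_trans (ler_dist_dist _ _) _.
by rewrite addrAC subrr add0r.
Qed.

(** A shift that does not cross 0 sees a linear function, so the increment equals the directional
    derivative exactly, with no remainder. *)
Lemma shifted_absE (r b x : R) : 0 < r -> (b != 0 -> `|x| <= r * `|b|) ->
  shifted_abs r b x = dabs b x.
Proof.
move=> r0 xb; rewrite /shifted_abs /dabs.
have [b0|b0|->] := ltgtP b 0; last first.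
- by rewrite mulr0 add0r normr0 subr0 /= mulr0 add0r mulr1.
- have := xb (lt0r_neq0 b0); rewrite (gtr0_norm b0) ler_norml => /andP[x1 x2].
  have rb : 0 < r * b by rewrite mulr_gt0.
  by rewrite gtr0_sg// (gtr0_norm rb) ger0_norm /=; lra.
- have := xb (ltr0_neq0 b0); rewrite (ltr0_norm b0) ler_norml => /andP[x1 x2].
  have rb : r * b < 0 by rewrite pmulr_rlt0.
  by rewrite ltr0_sg// (ltr0_norm rb) ler0_norm /=; lra.
Qed.

(** At [beta + r^-1 *: v] the criterion is [J v] plus a term independent of [v], up to [p] smoothing
    errors. Comparing two points spends this error twice. *)
Lemma penalized_rss_minimizer_scaled X e (beta b : 'cV[R]_p) (lambda s r : R) :
  0 < r -> 0 < s -> 0 <= lambda -> n%:R = r ^+ 2 ->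
  is_minimizer (penalized_rss X (X *m beta + e) lambda s) b ->
  let W := r^-1 *: (X^T *m e) in
  let J u := quad (n%:R^-1 *: (X^T *m X)) u - 2 * (\sum_i u i ord0 * W i ord0) +
    lambda / r * \sum_i shifted_abs r (beta i ord0) (u i ord0) in
  forall u, J (r *: (b - beta)) <= J u +
    2 * (lambda * (p%:R * (2 * (normal_peak (Num.sqrt 2)^-1 / normal_peak 1) * s))).
Proof.
move=> r0 s0 l0 nr mb W J u.
set K := 2 * (normal_peak _ / _).
have JE v : J v - lambda * (p%:R * (K * s)) <=
   penalized_rss X (X *m beta + e) lambda s (beta + r^-1 *: v) -
   mx11_val (e^T *m e) - lambda * \sum_i `|beta i ord0| <=
   J v + lambda * (p%:R * (K * s)).
  rewrite /penalized_rss.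
  have -> : X *m beta + e - X *m (beta + r^-1 *: v) = e - X *m (r^-1 *: v).
    by rewrite mulmxDr opprD addrA; congr (_ - _); rewrite addrAC subrr add0r.
  rewrite rss_expansion.
  have -> : mx11_val ((r^-1 *: v)^T *m (X^T *m e)) = \sum_i v i ord0 * W i ord0.
    rewrite linearZ/= -scalemxAl scalemxAr -/W mx11_val_dotE.
    by [].
  have -> : quad (X^T *m X) (r^-1 *: v) = quad (n%:R^-1 *: (X^T *m X)) v.
    rewrite quadZ /quad [(r^-1 *: v)^T]linearZ/= -!scalemxAl -scalemxAr !mx11_valZ.
    by rewrite mulrA nr expr2 invfM.
  have -> : J v = quad (n%:R^-1 *: (X^T *m X)) v - 2 * (\sum_i v i ord0 * W i ord0) +
      lambda * (\sum_i `|beta i ord0 + r^-1 * v i ord0| - \sum_i `|beta i ord0|).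
    rewrite /J; congr (_ + _); rewrite -mulrA; congr (_ * _).
    rewrite -sumrB mulr_sumr; apply: eq_bigr => i _.
    rewrite /shifted_abs mulrBr; congr (_ - _).
      rewrite -[r^-1 in LHS]gtr0_norm ?invr_gt0// -normrM mulrDr mulKf// gt_eqF//.
    by rewrite normrM (gtr0_norm r0) mulKf// gt_eqF.
  have : `|\sum_i (beta + r^-1 *: v) i ord0 *
      (2 * normal_cdf ((beta + r^-1 *: v) i ord0 / s) 0 (Num.sqrt 2)^-1 - 1) -
      \sum_i `|beta i ord0 + r^-1 * v i ord0| | <= p%:R * (K * s).
    rewrite -sumrB; apply: le_trans (ler_norm_sum _ _ _) _.
    rewrite mulr_natl -[p in X in _ <= X]card_ord -sumr_const.
    by apply: ler_sum => i _; rewrite !mxE; exact: smoothed_abs_error.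
  rewrite ler_norml => /andP[h1 h2].
  have := ler_wpM2l l0 h1; have := ler_wpM2l l0 h2.
  set S := \sum_i _ * (_ - 1); rewrite mulrN !mulrBr => h3 h4.
  by apply/andP; split; lra.
have /andP[h1 _] := JE (r *: (b - beta)).
have /andP[_ h2] := JE u.
have := mb (beta + r^-1 *: u).
have bE : beta + r^-1 *: (r *: (b - beta)) = b.
  by rewrite scalerA mulVf ?gt_eqF// scale1r addrC subrK.
by rewrite bE in h1; lra.
Qed.

End RssExpansion.

(** * Deterministic stability of approximate minimizers *)

Section NearMinimizer.
Context (R : realType) (p : nat).
Variables (beta : 'cV[R]_p) (Sigma C : 'M[R]_p) (lambda0 c L Lam rho r : R).
Hypothesis c_gt0 : 0 < c.
Hypothesis lambda0_ge0 : 0 <= lambda0.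
Hypothesis Sigma_pd : forall u, c * sqnorm u <= quad Sigma u.
Hypothesis r_gt0 : 0 < r.
Hypothesis Lam_ge0 : 0 <= Lam.
Implicit Types u v w : 'cV[R]_p.

Local Notation J := (fun w u => quad C u - 2 * (\sum_i u i ord0 * w i ord0) +
    Lam * \sum_i shifted_abs r (beta i ord0) (u i ord0)).

(** [J w] vanishes at 0. The form keeps half of its coercivity, and the other terms are at most
    [a * |x| <= c / 4 * x ^ 2 + a ^ 2 / c] per coordinate with [a = 2 * L + lambda0 + 1]; a quarter
    of [c] remains. *)
Lemma near_minimizer_bound w u : entry_sum (C - Sigma) <= c / 2 ->
  Lam <= lambda0 + 1 -> rho <= 1 -> box L w -> J w u <= J w 0 + rho ->
  sqnorm u <= 4 / c * (p%:R * (2 * L + lambda0 + 1) ^+ 2 / c + 1).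
Proof.
move=> CS Lam1 rho1 wL.
have -> : J w 0 = 0.
  rewrite /quad mulmx0 /mx11_val mxE big1 ?mulr0 ?subr0 ?add0r.
    rewrite big1 ?mulr0// => i _.
    by rewrite mxE /shifted_abs addr0 subrr.
  by move=> i _; rewrite mxE mul0r.
rewrite add0r => Ju.
have hC : c / 2 * sqnorm u <= quad C u.
  have := norm_quad_le (C - Sigma) u; rewrite quadB ler_norml => /andP[h1 _].
  have h2 := ler_wpM2r (sqnorm_ge0 u) CS.
  by have := Sigma_pd u; lra.
have hb : 2 * (\sum_i u i ord0 * w i ord0) -
    Lam * \sum_i shifted_abs r (beta i ord0) (u i ord0) <=
    c / 4 * sqnorm u + p%:R * ((2 * L + lambda0 + 1) ^+ 2 / c).
  rewrite [p%:R * _]mulr_natl -[p in X in _ <= _ + X]card_ord -sumr_const /sqnorm.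
  rewrite !mulr_sumr -sumrB -big_split/=; apply: ler_sum => i _.
  set x := u i ord0; set z := w i ord0; set a := 2 * L + lambda0 + 1.
  have hz : x * z <= `|x| * L.
    rewrite (le_trans (ler_norm _))// normrM ler_wpM2l//; exact: wL.
  have hs : - `|x| <= shifted_abs r (beta i ord0) x.
    by have := shifted_abs_le r (beta i ord0) x; rewrite ler_norml => /andP[].
  have hs' := ler_wpM2l Lam_ge0 hs.
  have hl : Lam * `|x| <= (lambda0 + 1) * `|x| by rewrite ler_wpM2r.
  have key : 0 <= (c * `|x| - 2 * a) ^+ 2 / (4 * c).
    by rewrite divr_ge0 ?sqr_ge0// mulr_ge0// ltW.
  have E : (c * `|x| - 2 * a) ^+ 2 / (4 * c) =
      c / 4 * x ^+ 2 - a * `|x| + a ^+ 2 / c.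
    by rewrite -[x ^+ 2]real_normK ?num_real//; field; rewrite gt_eqF.
  have aE : a * `|x| = 2 * (`|x| * L) + (lambda0 + 1) * `|x|.
    by rewrite /a; ring.
  by move: key; rewrite E aE; lra.
rewrite -ler_pdivrMl ?divr_gt0// invf_div.
by rewrite -[p%:R * _ / c]mulrA; lra.
Qed.

(** On the box the shifted penalty is exactly linearized, so [J w] and the limit objective differ
    only through [C - Sigma] and [Lam - lambda0]. The difference is paid at [u] and at [a], and
    quadratic growth turns the gap in values into a distance. *)
Lemma near_minimizer_close w u (K eta tau : R) :
  entry_sum (C - Sigma) <= eta -> `|Lam - lambda0| <= tau -> 0 <= K ->
  (forall i, beta i ord0 != 0 -> K <= r * `|beta i ord0|) ->
  let a := argmin (limit_objective beta Sigma lambda0 w) in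
  box K u -> box K a -> J w u <= J w a + rho ->
  c / 2 * sqnorm (u - a) <= 2 * (p%:R * (eta * K ^+ 2 + tau * K)) + rho.
Proof.
move=> CS Lt K0 Kb a uK aK Jua.
have amin := argmin_limit_objective beta lambda0_ge0 c_gt0 Sigma_pd w.
have := limit_objective_growth lambda0_ge0 Sigma_pd u amin.
rewrite -/a !limit_objectiveE => hg.
have dev v : box K v ->
    `|quad (C - Sigma) v + (Lam - lambda0) * \sum_i dabs (beta i ord0) (v i ord0)| <=
    p%:R * (eta * K ^+ 2 + tau * K).
  move=> vK; apply: le_trans (ler_normD _ _) _; rewrite mulrDr; apply: lerD.
    apply: le_trans (norm_quad_le _ _) _; rewrite mulrCA.
    apply: ler_pM => //; [exact: entry_sum_ge0|exact: sqnorm_ge0|].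
    rewrite mulr_natl -[p in X in _ <= X]card_ord -sumr_const.
    apply: ler_sum => i _; rewrite -[leLHS]real_normK ?num_real//.
    by rewrite ler_sqr ?nnegrE//; exact: vK.
  rewrite normrM mulrCA; apply: ler_pM => //.
  apply: le_trans (ler_norm_sum _ _ _) _.
  rewrite mulr_natl -[p in X in _ <= X]card_ord -sumr_const.
  apply: ler_sum => i _; apply: le_trans (vK i).
  by have := dabs_lipschitz (beta i ord0) (v i ord0) 0; rewrite dabs0 !subr0.
have sE v : box K v -> \sum_i shifted_abs r (beta i ord0) (v i ord0) =
    \sum_i dabs (beta i ord0) (v i ord0).
  move=> vK; apply: eq_bigr => i _; apply: shifted_absE => // b0.
  exact: le_trans (vK i) (Kb _ b0).
have := dev u uK; have := dev a aK; rewrite !quadB !ler_norml.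
move=> /andP[a1 a2] /andP[u1 u2].
by move: Jua; rewrite !sE//; lra.
Qed.

End NearMinimizer.

(** From [|x| <= 1 + x ^ 2], which spares a square root. *)
Lemma coord_le_sqnorm (R : realType) (p : nat) (u : 'cV[R]_p) (B : R) :
  sqnorm u <= B -> box (1 + B) u.
Proof.
move=> uB i; have := le_trans (sqr_coord_le u i) uB.
rewrite -[u i ord0 ^+ 2]real_normK ?num_real// => h.
have := sqr_ge0 (`|u i ord0| - 1); have := normr_ge0 (u i ord0); nra.
Qed.

Lemma powR_nat_cvg0 (R : realType) (eps : R) : 0 < eps ->
  (n%:R : R) `^ (- eps) @[n --> \oo] --> (0 : R).
Proof.
move=> e0.
have npos : \forall n \near \oo, 0 < (n%:R : R).
  by near=> n; rewrite ltr0n; near: n; exact: nbhs_infty_gt.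
have inv0 : (n%:R : R)^-1 @[n --> \oo] --> 0^'+.
  have inv : (n%:R : R)^-1 @[n --> \oo] --> (0 : R).
    by apply/gtr0_cvgV0 => //; exact: cvgr_idn.
  move=> A /inv; apply: filterS2 npos => n n0 /=; apply.
  by rewrite invr_gt0.
have := cvg_comp _ _ inv0 (powR_cvg0 e0).
apply: cvg_trans; apply: near_eq_cvg; near=> n => /=.
have n0 : 0 < n%:R :> R by rewrite ltr0n; near: n; exact: nbhs_infty_gt.
by rewrite /= -powR_inv1 ?ltW// -powRrM mulN1r.
Unshelve. all: by end_near. Qed.

(** * Rates and the limit theorem *)

Section GramLimit.
Context (R : realType) (p : nat).
Variables (X : forall n, 'M[R]_(n, p)) (Sigma : 'M[R]_p).
Local Notation C n := (n%:R^-1 *: ((X n)^T *m X n)).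
Hypothesis Ccvg : C n @[n --> \oo] --> Sigma.

Lemma gram_entry_cvg i j : C n i j @[n --> \oo] --> Sigma i j.
Proof. exact: (cvg_comp _ _ Ccvg (@coord_continuous _ _ _ i j Sigma)). Qed.

Lemma gram_entry_sum_cvg0 : entry_sum (C n - Sigma) @[n --> \oo] --> (0 : R).
Proof.
rewrite (_ : 0 = \sum_(i < p) \sum_(j < p) `|Sigma i j - Sigma i j|); last first.
  by rewrite big1// => i _; rewrite big1// => j _; rewrite subrr normr0.
apply: cvgr_sum => i; apply: cvgr_sum => j.
apply: cvg_norm; under eq_fun do rewrite mxE [X in _ + X]mxE.
by apply: cvgB; [exact: gram_entry_cvg|exact: cvg_cst].
Qed.

Lemma gram_quad_cvg u : quad (C n) u @[n --> \oo] --> quad Sigma u.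
Proof.
rewrite quadE; under eq_fun do rewrite quadE.
apply: cvgr_sum => i; apply: cvgr_sum => j; apply: cvgM; last exact: cvg_cst.
by apply: cvgM; [exact: cvg_cst|exact: gram_entry_cvg].
Qed.

Lemma gram_quad_ge0 n u : 0 <= quad (C n) u.
Proof.
rewrite quadZ mulr_ge0// ?invr_ge0//.
have -> : quad ((X n)^T *m X n) u = sqnorm (X n *m u).
  by rewrite -mx11_val_sqnorm /quad trmx_mul !mulmxA.
exact: sqnorm_ge0.
Qed.

(** Symmetry here and positivity below are inherited from the Gram matrices; with non-singularity
    they make [Sigma] positive definite. *)
Lemma gram_limit_sym : Sigma^T = Sigma.
Proof.
apply/matrixP => i j; rewrite mxE.
have := @gram_entry_cvg j i; have -> : (fun n => C n j i) = (fun n => C n i j).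
  apply/funext => n; rewrite [LHS]mxE [RHS]mxE; congr (_ * _).
  by rewrite -[in LHS](trmxK ((X n)^T *m X n)) mxE trmx_mul trmxK.
by move=> h; apply: (cvg_unique _ h (@gram_entry_cvg i j)).
Qed.

Lemma gram_limit_psd u : 0 <= quad Sigma u.
Proof.
by apply: (cvgr_to_ge (@gram_quad_cvg u)); apply: nearW => n; exact: gram_quad_ge0.
Qed.

End GramLimit.

Section Rates.
Context (R : realType).

Lemma sqrt_nat_cvgy : (Num.sqrt (n%:R : R)) @[n --> \oo] --> +oo%R.
Proof.
apply/cvgryPge => A; near=> n.
have hn : A ^+ 2 <= n%:R by near: n; exact: nbhs_infty_ger.
rewrite (le_trans (ler_norm A))// -sqrtr_sqr ler_wsqrtr//.
Unshelve. all: by end_near. Qed.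

(* [lambda n * s_ n = (lambda n / sqrt n) * s * n^-eps] for [n > 0] *)
Lemma penalty_error_cvg0 (s eps lambda0 K : R) (s_ lambda : nat -> R) : 0 < eps ->
  (forall n, s_ n = s / n%:R `^ (1 / 2 + eps)) ->
  lambda n / Num.sqrt n%:R @[n --> \oo] --> lambda0 ->
  K * (lambda n * s_ n) @[n --> \oo] --> (0 : R).
Proof.
move=> e0 sE lc.
rewrite (_ : 0 = K * (lambda0 * (s * 0))); last by rewrite !mulr0.
apply: cvgM; first exact: cvg_cst.
have : lambda n / Num.sqrt n%:R * (s * (n%:R : R) `^ (- eps)) @[n --> \oo] -->
    lambda0 * (s * 0).
  by apply: cvgM => //; apply: cvgM; [exact: cvg_cst|exact: powR_nat_cvg0].
apply: cvg_trans; apply: near_eq_cvg; near=> n.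
have n0 : 0 < n%:R :> R by rewrite ltr0n; near: n; exact: nbhs_infty_gt.
rewrite sE powRD; last by rewrite (gt_eqF n0) implybT.
rewrite div1r powR12_sqrt ?ltW// powRN invfM.
by rewrite -!mulrA; congr (_ * _); rewrite mulrCA.
Unshelve. all: by end_near. Qed.

(** The sum dominates each [1 / |beta i|], and zero coordinates add nothing because the inverse of 0
    is 0. It gives a single threshold on [r] for all nonzero coordinates. *)
Lemma nonzero_entries_bound (p : nat) (beta : 'cV[R]_p) (K r : R) : 0 <= K ->
  K * \sum_i `|beta i ord0|^-1 <= r ->
  forall i, beta i ord0 != 0 -> K <= r * `|beta i ord0|.
Proof.
move=> K0 Kr i b0; rewrite -ler_pdivrMr ?normr_gt0//.
apply: le_trans Kr; rewrite ler_wpM2l// (bigD1 i)//= lerDl.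
by apply: sumr_ge0 => j _; rewrite invr_ge0.
Qed.

End Rates.

Theorem theorem3p2 (R : realType) (p : nat) (beta : 'cV[R]_p) (sigma : R)
    (d : nat -> measure_display) (Omega : forall n, measurableType (d n))
    (P : forall n, probability (Omega n) R)
    (X : forall n, 'M[R]_(n, p))
    (e : forall n, Omega n -> 'cV[R]_n)
    (y : forall n, Omega n -> 'cV[R]_n)
    (s eps : R) (s_ lambda : nat -> R) (lambda0 : R) (Sigma : 'M[R]_p)
    (betahat : forall n, Omega n -> 'cV[R]_p)
    (d' : measure_display) (Omega' : measurableType d')
    (P' : probability Omega' R) (W : Omega' -> 'cV[R]_p)
    (he : forall n, normal_vector (P n) (e n) 0 (sigma ^+ 2 *: 1%:M))
    (hy : forall n w, y n w = X n *m beta + e n w)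
    (hs : 0 < s) (heps : 0 < eps)
    (hs_ : forall n, s_ n = s / n%:R `^ (1 / 2 + eps))
    (hlambda : forall n, 0 <= lambda n)
    (hlambda0 : 0 <= lambda0)
    (hlambda_cvg : lambda n / Num.sqrt n%:R @[n --> \oo] --> lambda0)
    (hSigma_cvg : n%:R^-1 *: ((X n)^T *m X n) @[n --> \oo] --> Sigma)
    (hSigma : Sigma \in unitmx)
    (hbetahat_rv : forall n, random_vector (betahat n))
    (hbetahat : forall n w,
       is_minimizer (penalized_rss (X n) (y n w) (lambda n) (s_ n))
         (betahat n w))
    (hW : normal_vector P' W 0 (sigma ^+ 2 *: Sigma)) :
  let U := fun w => argmin (limit_objective beta Sigma lambda0 (W w)) in
  [/\ forall w, exists! u,
        is_minimizer (limit_objective beta Sigma lambda0 (W w)) u,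
      random_vector U &
      cvg_in_distribution P
        (fun n w => Num.sqrt n%:R *: (betahat n w - beta)) P' U].
Proof.
move=> U.
have [c c0 cS] := psd_unitmx_pd (gram_limit_sym hSigma_cvg)
  (gram_limit_psd hSigma_cvg) hSigma.
have mW : random_vector W := hW.1.
pose A w := argmin (limit_objective beta Sigma lambda0 w).
have cA : continuous A.
  exact: (@argmin_continuous _ _ beta Sigma lambda0 c hlambda0 c0 cS).
have mU : random_vector U.
  move=> i; apply: (measurable_continuous_comp mW (f := fun w => A w i ord0)).
  move=> w; exact: (continuous_comp (cA w) (@coord_continuous _ _ _ i ord0 (A w))).
split => //; first by move=> w; exact: (limit_objective_unique beta hlambda0 c0 cS).
pose C n := n%:R^-1 *: ((X n)^T *m X n).
pose r n : R := Num.sqrt n%:R.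
have rr n : r n ^+ 2 = n%:R by rewrite sqr_sqrtr.
pose Z n w : 'cV[R]_p := (r n)^-1 *: ((X n)^T *m e n w).
have ZE n w (a : 'cV[R]_p) :
    mx11_val (a^T *m Z n w) = mx11_val (((r n)^-1 *: (X n *m a))^T *m e n w).
  by rewrite /Z [(_ *: (_ *m a))^T]linearZ/= trmx_mul -scalemxAl -scalemxAr mulmxA.
have mZa n (a : 'cV[R]_p) : measurable_fun setT (fun w => mx11_val (a^T *m Z n w)).
  by under eq_fun do rewrite ZE; exact: (measurable_mx11_dot (he n).1).
have coordE (x : 'cV[R]_p) i : mx11_val ((delta_mx i ord0)^T *m x) = x i ord0.
  by rewrite trmx_delta -rowE /mx11_val mxE.
have mZ n : random_vector (Z n).
  by move=> i; have := mZa n (delta_mx i ord0); under eq_fun do rewrite coordE.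
(* A projection of [Z n] is a projection of the noise, hence normal. This covers [n = 0] too, where
   the inverses of [r n] and of [n%:R] are both 0. *)
have lZ n a (B : set R) : measurable B ->
    P n ((fun w => mx11_val (a^T *m Z n w)) @^-1` B) =
    normal_law 0 (sigma ^+ 2 * quad (C n) a) B.
  move=> mB; have := (he n).2 ((r n)^-1 *: (X n *m a)) B mB.
  have <- : (fun w => mx11_val (a^T *m Z n w)) =
      (fun w => mx11_val (((r n)^-1 *: (X n *m a))^T *m e n w)).
    by apply/funext => w; rewrite ZE.
  move=> ->; congr (normal_law _ _ B).
    by rewrite mulmx0 /mx11_val mxE.
  rewrite -/(quad _ _) quadZ; congr (_ * _).
  rewrite /quad mulmx1 [((r n)^-1 *: _)^T]linearZ/= -scalemxAl -scalemxAr !mx11_valZ.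
  by rewrite mulrA -invfM -expr2 rr trmx_mul /C -scalemxAr -scalemxAl mx11_valZ !mulmxA.
have lW a (B : set R) : measurable B ->
    P' ((fun w => mx11_val (a^T *m W w)) @^-1` B) =
    normal_law 0 (sigma ^+ 2 * quad Sigma a) B.
  move=> mB; rewrite (hW.2 a B mB) -/(quad (sigma ^+ 2 *: Sigma) a) quadZ.
  congr (normal_law _ _ B).
  by rewrite mulmx0 /mx11_val mxE.
have Zcvg (a : 'cV[R]_p) (h : R -> R) (M : R) :
    continuous h -> (forall x, `|h x| <= M) ->
    \int[P n]_w h (mx11_val (a^T *m Z n w)) @[n --> \oo] -->
    \int[P']_w h (mx11_val (a^T *m W w)).
  move=> ch hM.
  apply: (normal_law_cvg (fun n => mZa n a) (measurable_mx11_dot mW a)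
    _ _ (fun n => lZ n a) (lW a) _ ch hM).
  - by move=> n; rewrite mulr_ge0 ?sqr_ge0// gram_quad_ge0.
  - by rewrite mulr_ge0 ?sqr_ge0// (gram_limit_psd hSigma_cvg).
  - by apply: cvgM; [exact: cvg_cst|exact: gram_quad_cvg].
pose Y n w : 'cV[R]_p := r n *: (betahat n w - beta).
have mY n : random_vector (Y n).
  move=> i; rewrite /Y; under eq_fun do rewrite !mxE.
  apply: measurable_funM; first exact: measurable_cst.
  by apply: measurable_funB; [exact: hbetahat_rv|exact: measurable_cst].
pose K0 : R := normal_peak (Num.sqrt 2)^-1 / normal_peak 1.
pose rho n := 2 * (lambda n * (p%:R * (2 * K0 * s_ n))).
have rho0 : rho n @[n --> \oo] --> (0 : R).
  have -> : rho = fun n => 2 * (p%:R * (2 * K0)) * (lambda n * s_ n).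
    by apply/funext => n; rewrite /rho; ring.
  exact: (penalty_error_cvg0 _ heps hs_ hlambda_cvg).
have eta0 := gram_entry_sum_cvg0 hSigma_cvg.
have n_gt0 : \forall n \near \oo, (0 < n)%N by exact: nbhs_infty_gt.
have Jmin n w : (0 < n)%N -> forall u,
    quad (C n) (Y n w) - 2 * (\sum_i Y n w i ord0 * Z n w i ord0) +
      lambda n / r n * \sum_i shifted_abs (r n) (beta i ord0) (Y n w i ord0) <=
    quad (C n) u - 2 * (\sum_i u i ord0 * Z n w i ord0) +
      lambda n / r n * \sum_i shifted_abs (r n) (beta i ord0) (u i ord0) + rho n.
  move=> n0 u; have nR : 0 < n%:R :> R by rewrite ltr0n.
  apply: (penalized_rss_minimizer_scaled (s := s_ n)) => //.
  - by rewrite sqrtr_gt0.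
  - by rewrite hs_ divr_gt0// powR_gt0.
  - by rewrite -hy; exact: hbetahat.
have key L : exists K, forall eps', 0 < eps' -> \forall n \near \oo,
    forall w, box L (Z n w) -> [/\ box K (Y n w), box K (A (Z n w)) &
      forall i, `|Y n w i ord0 - A (Z n w) i ord0| < eps'].
  (* [B1] bounds [sqnorm (Y n w)] through [near_minimizer_bound]; [B2] bounds [sqnorm (A w)] through
     the Lipschitz estimate against [A 0]. Neither depends on the tolerance. *)
  pose B1 := 4 / c * (p%:R * (2 * L + lambda0 + 1) ^+ 2 / c + 1).
  pose B2 := 2 * (4 / c ^+ 2 * (p%:R * L ^+ 2) + sqnorm (A 0)).
  have B10 : 0 <= B1.
    apply: mulr_ge0; first by rewrite divr_ge0// ltW.
    apply: addr_ge0 => //; apply: divr_ge0; last exact: ltW.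
    by apply: mulr_ge0 => //; exact: sqr_ge0.
  have B20 : 0 <= B2.
    apply: mulr_ge0 => //; apply: addr_ge0; last exact: sqnorm_ge0.
    by apply: mulr_ge0; [rewrite divr_ge0 ?sqr_ge0|rewrite mulr_ge0 ?sqr_ge0].
  pose K := 1 + (B1 + B2).
  have K_ge0 : 0 <= K by rewrite addr_ge0// addr_ge0.
  have AL w : box L w -> box K (A w).
    move=> wL; apply: coord_le_sqnorm.
    have h1 := argmin_lipschitz beta hlambda0 c0 cS w 0.
    have h2 := sqnormD_le (A w - A 0) (A 0); rewrite subrK in h2.
    apply: (le_trans h2); rewrite -[leLHS]add0r; apply: lerD => //.
    rewrite ler_pM2l// lerD2r; apply: (le_trans h1).
    rewrite ler_wpM2l ?divr_ge0 ?sqr_ge0// subr0.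
    rewrite mulr_natl -[p in X in _ <= X]card_ord -sumr_const.
    apply: ler_sum => i _; rewrite -[leLHS]real_normK ?num_real//.
    by rewrite ler_sqr ?nnegrE//; exact: le_trans (normr_ge0 _) (wL i).
  exists K => e1 e10.
  (* The right side of [near_minimizer_close], with the actual deviations at stage [n] as its [eta]
     and [tau]. *)
  pose g n := 2 * (p%:R * (entry_sum (C n - Sigma) * K ^+ 2 +
    `|lambda n / r n - lambda0| * K)) + rho n.
  have g0 : g n @[n --> \oo] --> (0 : R).
    rewrite (_ : 0 = 2 * (p%:R * (0 * K ^+ 2 + `|lambda0 - lambda0| * K)) + 0); last first.
      by rewrite subrr normr0 !mul0r !addr0 !mulr0.
    apply: cvgD => //; apply: cvgM; first exact: cvg_cst.
    apply: cvgM; first exact: cvg_cst.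
    apply: cvgD; apply: cvgM; [by []|exact: cvg_cst| |exact: cvg_cst].
    by apply: cvg_norm; apply: cvgB => //; exact: cvg_cst.
  have ce0 : 0 < c / 2 * e1 ^+ 2 by rewrite mulr_gt0 ?divr_gt0 ?exprn_gt0.
  have c20 : 0 < c / 2 by rewrite divr_gt0.
  have l1 : lambda0 < lambda0 + 1 by rewrite ltrDl.
  have /cvgryPge rny := @sqrt_nat_cvgy R.
  near=> n.
  have n0 : (0 < n)%N by near: n.
  have nR : 0 < n%:R :> R by rewrite ltr0n.
  have r0 : 0 < r n by rewrite sqrtr_gt0.
  have gn : g n < c / 2 * e1 ^+ 2 by near: n; exact: (cvgr_lt _ g0).
  have etan : entry_sum (C n - Sigma) <= c / 2 by near: n; exact: (cvgr_le _ eta0).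
  have Lamn : lambda n / r n <= lambda0 + 1 by near: n; exact: (cvgr_le _ hlambda_cvg).
  have rhon : rho n <= 1 by near: n; exact: (cvgr_le _ rho0).
  have rn : K * \sum_i `|beta i ord0|^-1 <= r n.
    by near: n; exact: rny.
  have Lam0 : 0 <= lambda n / r n by rewrite divr_ge0// ltW.
  move=> w wL; have KA := AL _ wL.
  have KY : box K (Y n w).
    (* The estimator is first compared with [u = 0] to confine it to the box, and then with
       [A (Z n w)] to locate it. *)
    apply: coord_le_sqnorm; rewrite -[leLHS]addr0; apply: lerD => //.
    exact: (near_minimizer_bound c0 cS Lam0 etan Lamn rhon wL (Jmin n w n0 0)).
  have close := near_minimizer_close c0 hlambda0 cS r0 (lexx _) (lexx _) K_ge0
    (nonzero_entries_bound K_ge0 rn) KY KA (Jmin n w n0 _).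
  split => // i.
  have h : (Y n w i ord0 - A (Z n w) i ord0) ^+ 2 < e1 ^+ 2.
    have := sqr_coord_le (Y n w - A (Z n w)) i; rewrite !mxE => /le_lt_trans; apply.
    by rewrite -(ltr_pM2l c20); apply: le_lt_trans gn.
  by rewrite -[ltLHS]normr_id -[ltRHS]gtr0_norm// -ltr_sqr ?nnegrE// !real_normK ?num_real.
move=> f cf [M fM].
have fMY n w : `|(f \o Y n) w| <= M by exact: fM.
have fMU w : `|(f \o U) w| <= M by exact: fM.
have mfY n := measurable_continuous_comp (mY n) cf.
have mfU := measurable_continuous_comp mU cf.
rewrite (expectation_Rintegral P' mfU fMU).
under eq_fun do rewrite (expectation_Rintegral (P _) (mfY _) (fMY _)).
apply: cvg_EFin; first exact: nearW.
exact: (Rintegral_cvg_asymptotic_image mZ mW Zcvg mY cA cf fM key).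
Unshelve. all: by end_near. Qed.
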